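(* Let $q\ge 2$ be an even integer, $s\in(0,2)$, and let $P(x,t)=|\Psi(x,t)|^2$ be as in the context. Define the average position $\langle x\rangle(t)=\int_0^\pi x\,P(x,t)\,dx$ and the average velocity $v(t)=\frac{d\langle x\rangle}{dt}(t)$. Then $v$ is continuous, and its graph over any compact interval $[a,b]$ with $a<b$ has box-counting dimension $D_v=\max\{(1+s)/2,\,1\}$.
   Context: For an integer $q\ge2$ and $s\in(0,2)$ define, for $x\in[0,\pi]$ and $t\in\mathbb R$, $$\Psi(x,t)=N\sum_{n=0}^{\infty} q^{n(s-2)}\sin(q^n x)\,e^{-i q^{2n} t},\qquad N=\sqrt{\tfrac{2}{\pi}\big(1-q^{2(s-2)}\big)}.$$ Let $P(x,t)=|\Psi(x,t)|^2$. Box-counting dimension of a bounded planar set: $\lim_{\delta\to0}\ln N(\delta)/\ln(1/\delta)$, where $N(\delta)$ is the number of squares of the $\delta$-grid meeting the set. Upper and lower versions use $\limsup$ and $\liminf$, and the dimension exists when they agree. *)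

(* Defs.v *)
From Stdlib Require Import Reals Lra Lia ZArith List.
From Coquelicot Require Import Coquelicot.
Open Scope R_scope.

Definition coefW (q : nat) (s : R) (n : nat) : R :=
  Rpower (INR q) (INR n * (s - 2)).

Definition Nnorm (q : nat) (s : R) : R :=
  sqrt (2 / PI * (1 - Rpower (INR q) (2 * (s - 2)))).

(* Psi(x,t) = N sum_n q^{n(s-2)} sin(q^n x) e^{-i q^{2n} t}, written via its
   real and imaginary parts (e^{-i th} = cos th - i sin th). *)
Definition RePsi (q : nat) (s x t : R) : R :=
  Nnorm q s * Series (fun n => coefW q s n * sin (INR q ^ n * x)
                                 * cos (INR q ^ (2 * n) * t)).

Definition ImPsi (q : nat) (s x t : R) : R :=
  - (Nnorm q s * Series (fun n => coefW q s n * sin (INR q ^ n * x)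
                                    * sin (INR q ^ (2 * n) * t))).

Definition Pdens (q : nat) (s x t : R) : R :=
  RePsi q s x t ^ 2 + ImPsi q s x t ^ 2.

Definition avg_x (q : nat) (s t : R) : R :=
  RInt (fun x => x * Pdens q s x t) 0 PI.

Definition graph_on (f : R -> R) (a b : R) : R * R -> Prop :=
  fun p => a <= fst p <= b /\ snd p = f (fst p).

Definition meets_square (S : R * R -> Prop) (d : R) (i j : Z) : Prop :=
  exists p, S p /\
    IZR i * d <= fst p <= (IZR i + 1) * d /\
    IZR j * d <= snd p <= (IZR j + 1) * d.

Definition box_count (S : R * R -> Prop) (d : R) (n : nat) : Prop :=
  exists l : list (Z * Z), NoDup l /\ length l = n /\
    forall i j, In (i, j) l <-> meets_square S d i j.

Definition has_box_dim (S : R * R -> Prop) (D : R) : Prop :=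
  forall eps, 0 < eps -> exists d0, 0 < d0 /\
    forall d, 0 < d < d0 -> exists n, box_count S d n /\
      Rabs (ln (INR n) / ln (1 / d) - D) < eps.

(* Main.v *)
(* For even q the integral of x sin(q^n x) sin(q^m x) over [0, pi] vanishes off the
   diagonal unless n or m is 0, so <x>(t) is a constant plus a single cosine series in
   the frequencies q^(2m) - 1, and v is the sine series with coefficients of exact
   order q^(m(s-3)).  With Q = q^2 and alpha = (3-s)/2 this is a Weierstrass-type
   series with amplitudes Q^(-alpha m) and frequencies about Q^m.

   Upper bound: v is beta-Hoelder for every beta < min(alpha, 1), which bounds the
   number of squares in each column of the grid.

   Lower bound: every column contains a square, which settles alpha >= 1.  If
   alpha < 1, test v(t) - v(t+h) against sin((Q^m - 1) t), where h is half a period of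
   this harmonic and h is comparable to the mesh d.  The m-th coefficient dominates
   all other terms, so the integral is at least of order d^alpha; on the other hand it
   is at most 2 d^2 times the number of squares, because the oscillation of v in a
   column is at most d times the number of squares of that column. *)

Require Import Defs.
From Stdlib Require Import Reals Lra Lia ZArith List ClassicalEpsilon FunctionalExtensionality.
From Coquelicot Require Import Coquelicot.
Open Scope R_scope.


(** * Normally convergent series of functions *)

Lemma ex_series_dominated (u A : nat -> R) :
  (forall n, Rabs (u n) <= A n) -> ex_series A -> ex_series u.
Proof. intros Hu HA. apply (@ex_series_le R_AbsRing R_CompleteNormedModule u A); auto. Qed.

Lemma Series_dominated (u A : nat -> R) :
  (forall n, Rabs (u n) <= A n) -> ex_series A -> Rabs (Series u) <= Series A.
Proof.
  intros Hu HA.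
  apply Rle_trans with (Series (fun n => Rabs (u n))).
  - apply Series_Rabs, (ex_series_dominated _ A); auto.
    intros n; rewrite Rabs_Rabsolu; apply Hu.
  - apply Series_le; auto. intros n; split; [apply Rabs_pos | apply Hu].
Qed.

(** The terms may have either sign, so the comparison is made on the nonnegative difference
    [w - u]. *)
Lemma Series_le_series (u w : nat -> R) :
  ex_series u -> ex_series w -> (forall n, u n <= w n) -> Series u <= Series w.
Proof.
  intros Hu Hw H.
  assert (0 <= Series (fun n => w n - u n)).
  { apply Rle_trans with (Series (fun n => 0 * w n)).
    { rewrite Series_scal_l; lra. }
    apply Series_le.
    - intros n; specialize (H n); lra.
    - apply (ex_series_minus w u); auto. }
  rewrite Series_minus in H0; auto. lra.
Qed.

(** The tail beyond [n] is itself a dominated series. When [u] depends on a point and [A] does not,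
    the bound is uniform in that point; the continuity and integration lemmas below rest on this. *)
Lemma Series_tail_dominated (u A : nat -> R) (n : nat) :
  (forall k, Rabs (u k) <= A k) -> ex_series A ->
  Rabs (Series u - sum_n u n) <= Series A - sum_n A n.
Proof.
  intros Hu HA.
  assert (Eu := ex_series_dominated u A Hu HA).
  rewrite !sum_n_Reals, (Series_incr_n u (S n)), (Series_incr_n A (S n)); auto; try lia.
  simpl pred.
  replace (_ + _ - _) with (Series (fun k => u (S n + k)%nat)) by ring.
  replace (_ + _ - _) with (Series (fun k => A (S n + k)%nat)) by ring.
  apply Series_dominated; auto.
  apply (ex_series_incr_n A (S n)); auto.
Qed.

Lemma Series_tail_small (A : nat -> R) (eps : R) :
  ex_series A -> 0 < eps ->
  exists N, forall n, (N <= n)%nat -> Series A - sum_n A n < eps.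
Proof.
  intros HA He.
  assert (H := Series_correct A HA).
  apply (proj1 (filterlim_locally (sum_n A) (Series A))) with (eps := mkposreal eps He) in H.
  destruct H as [N HN]. exists N; intros n Hn. specialize (HN n Hn).
  cbv in HN. change (Rabs (sum_n A n - Series A) < eps) in HN.
  apply Rabs_lt_between in HN. lra.
Qed.

Section NormalSeries.

Variables (f : nat -> R -> R) (A : nat -> R).
Hypothesis f_le : forall n x, Rabs (f n x) <= A n.
Hypothesis A_sum : ex_series A.
Hypothesis f_cont : forall n x, continuous (f n) x.

Lemma continuous_partial_sum (n : nat) (x : R) :
  continuous (fun y => sum_n (fun k => f k y) n) x.
Proof.
  induction n as [|n IH].
  - apply continuous_ext with (f 0%nat); auto. intros y; now rewrite sum_O.
  - apply continuous_ext with (fun y => plus (sum_n (fun k => f k y) n) (f (S n) y)).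
    + intros y; now rewrite sum_Sn.
    + apply @continuous_plus; auto.
Qed.

(** An eps/3 argument: one partial sum approximates the series uniformly, its error being bounded by
    the tail of [A]. *)
Lemma continuous_normal_series (x : R) :
  continuous (fun y => Series (fun n => f n y)) x.
Proof.
  apply filterlim_locally. intros eps.
  destruct (Series_tail_small A (eps / 3) A_sum) as [N HN].
  { destruct eps; simpl; lra. }
  assert (He3 : 0 < eps / 3) by (destruct eps; simpl; lra).
  assert (Hc := continuous_partial_sum N x).
  apply (proj1 (filterlim_locally _ _)) with (eps := mkposreal _ He3) in Hc.
  revert Hc; apply filter_imp; intros y Hy.
  change (Rabs (sum_n (fun k => f k y) N - sum_n (fun k => f k x) N) < eps / 3) in Hy.
  change (Rabs (Series (fun n => f n y) - Series (fun n => f n x)) < eps).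
  assert (H1 := Series_tail_dominated (fun n => f n y) A N (fun k => f_le k y) A_sum).
  assert (H2 := Series_tail_dominated (fun n => f n x) A N (fun k => f_le k x) A_sum).
  specialize (HN N (le_n N)).
  apply Rabs_lt_between in Hy. apply Rabs_le_between in H1. apply Rabs_le_between in H2.
  apply Rabs_lt_between. lra.
Qed.

Variable g : R -> R.
Hypothesis g_cont : forall x, continuous g x.

Lemma is_RInt_partial_sum (a b : R) (n : nat) :
  is_RInt (fun x => g x * sum_n (fun k => f k x) n) a b
          (sum_n (fun k => RInt (fun x => g x * f k x) a b) n).
Proof.
  assert (Hk : forall k, is_RInt (fun x => g x * f k x) a b
                           (RInt (fun x => g x * f k x) a b)).
  { intros k. apply (@RInt_correct R_CompleteNormedModule), ex_RInt_continuous.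
    intros z _. apply (continuous_mult g (f k)); auto. }
  induction n as [|n IH].
  - rewrite sum_O. apply (is_RInt_ext (fun x => g x * f 0%nat x)); auto.
    intros x _. now rewrite sum_O.
  - rewrite sum_Sn.
    apply (is_RInt_ext (fun x => plus (g x * sum_n (fun k => f k x) n) (g x * f (S n) x))).
    + intros x _. rewrite sum_Sn. cbn -[sum_n]. unfold plus; simpl; ring.
    + apply @is_RInt_plus; auto.
Qed.

Lemma continuous_mult_normal_series (x : R) :
  continuous (fun y => g y * Series (fun n => f n y)) x.
Proof.
  apply (continuous_mult g (fun y => Series (fun n => f n y))); auto.
  apply continuous_normal_series.
Qed.

(** The remainder of the integrated series is at most |b - a| G times the tail of [A]. The weight
    [g] lets one statement serve plain integration, first moments and testing against a harmonic. *)
Lemma is_series_RInt_normal_series (a b G : R) :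
  (forall x, Rmin a b <= x <= Rmax a b -> Rabs (g x) <= G) ->
  is_series (fun n => RInt (fun x => g x * f n x) a b)
            (RInt (fun x => g x * Series (fun n => f n x)) a b).
Proof.
  intros HG.
  set (L := RInt _ a b).
  assert (HL : is_RInt (fun x => g x * Series (fun n => f n x)) a b L).
  { apply (@RInt_correct R_CompleteNormedModule), ex_RInt_continuous.
    intros z _. apply continuous_mult_normal_series. }
  assert (G0 : 0 <= G).
  { apply Rle_trans with (Rabs (g a)); [apply Rabs_pos | apply HG].
    split; [apply Rmin_l | apply Rmax_l]. }
  apply filterlim_locally. intros eps.
  (* The added 1 keeps [K] positive even when a = b or G = 0. *)
  set (K := Rabs (b - a) * G + 1).
  assert (HK : 0 < K).
  { assert (H := Rmult_le_pos _ _ (Rabs_pos (b - a)) G0). unfold K; lra. }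
  destruct (Series_tail_small A (eps / K) A_sum) as [N HN].
  { apply Rdiv_lt_0_compat; auto. apply cond_pos. }
  exists N. intros n Hn. specialize (HN n Hn).
  set (s := sum_n _ n).
  change (Rabs (s - L) < eps).
  assert (Hd := is_RInt_minus _ _ _ _ _ _ (is_RInt_partial_sum a b n) HL).
  fold s in Hd.
  apply norm_RInt_le_const_abs with (M := G * (Series A - sum_n A n)) in Hd.
  - change (Rabs (s - L) <= Rabs (b - a) * (G * (Series A - sum_n A n))) in Hd.
    apply Rle_lt_trans with (1 := Hd).
    assert (T0 : 0 <= Series A - sum_n A n).
    { eapply Rle_trans; [apply Rabs_pos|].
      apply (Series_tail_dominated (fun n => f n 0) A n); auto. }
    apply Rle_lt_trans with (K * (Series A - sum_n A n)).
    { unfold K. lra. }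
    apply Rlt_le_trans with (K * (eps / K)).
    + now apply Rmult_lt_compat_l.
    + right; field; lra.
  - intros x Hx.
    change (Rabs (g x * sum_n (fun k => f k x) n - g x * Series (fun k => f k x))
             <= G * (Series A - sum_n A n)).
    rewrite <- Rmult_minus_distr_l, Rabs_mult.
    apply Rmult_le_compat; try apply Rabs_pos; auto.
    rewrite Rabs_minus_sym. apply (Series_tail_dominated (fun n => f n x)); auto.
Qed.

End NormalSeries.


(** * Termwise differentiation of cosine series *)

Lemma continuous_derivable (f : R -> R) (x : R) : ex_derive f x -> continuous f x.
Proof. apply (@ex_derive_continuous R_AbsRing R_NormedModule). Qed.

Ltac cont := apply continuous_derivable; auto_derive; auto.

(** Restates an equation over the carrier of an algebraic structure as one over [R], where [ring]
    and [field] recognise it. *)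
Ltac eqR := match goal with |- ?a = ?b => change (@eq R a b) end.

Lemma Rabs_mult_le_bounded (a c : R) : Rabs c <= 1 -> Rabs (a * c) <= Rabs a.
Proof.
  intros H. rewrite Rabs_mult. rewrite <- (Rmult_1_r (Rabs a)) at 2.
  apply Rmult_le_compat_l; auto. apply Rabs_pos.
Qed.

Lemma Rabs_sin_le_1 (x : R) : Rabs (sin x) <= 1.
Proof. apply Rabs_le. destruct (SIN_bound x); lra. Qed.

Lemma Rabs_cos_le_1 (x : R) : Rabs (cos x) <= 1.
Proof. apply Rabs_le. destruct (COS_bound x); lra. Qed.

Lemma is_RInt_of_derive (f df : R -> R) (a b : R) :
  (forall x, is_derive f x (df x)) -> (forall x, continuous df x) ->
  is_RInt df a b (f b - f a).
Proof. intros H1 H2. apply (is_RInt_derive f df); auto. Qed.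

(* The termwise derivative is integrated back termwise, which avoids a separate
   theorem on differentiation of series. *)
Lemma is_derive_cos_series (b om : nat -> R) (t : R) :
  ex_series (fun n => Rabs (b n)) -> ex_series (fun n => Rabs (b n * om n)) ->
  is_derive (fun t => Series (fun n => b n * cos (om n * t))) t
            (Series (fun n => - (b n * om n) * sin (om n * t))).
Proof.
  intros Hb Ha.
  set (f := fun n x => - (b n * om n) * sin (om n * x)).
  set (A := fun n => Rabs (b n * om n)).
  set (V := fun x => Series (fun n => f n x)).
  assert (fA : forall n x, Rabs (f n x) <= A n).
  { intros n x. unfold f, A. rewrite <- (Rabs_Ropp (b n * om n)).
    apply Rabs_mult_le_bounded, Rabs_sin_le_1. }
  assert (fc : forall n x, continuous (f n) x) by (intros n x; unfold f; cont).
  assert (Vc : forall x, continuous V x).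
  { intros x. now apply (continuous_normal_series f A). }
  assert (Hcos : forall x, ex_series (fun n => b n * cos (om n * x))).
  { intros x. apply ex_series_dominated with (2 := Hb).
    intros n; apply Rabs_mult_le_bounded, Rabs_cos_le_1. }
  set (F := fun t => Series (fun n => b n * cos (om n * t))).
  assert (HI : forall x, is_RInt V 0 x (F x - F 0)).
  { intros x.
    assert (HS := is_series_RInt_normal_series f A fA Ha fc (fun _ => 1)
                    (fun z => continuous_const 1 z) 0 x 1).
    assert (E : RInt (fun x => 1 * Series (fun n => f n x)) 0 x = F x - F 0).
    { rewrite <- (is_series_unique _ _ (HS ltac:(intros; cbv beta; rewrite Rabs_R1; lra))).
      unfold F; rewrite <- Series_minus; auto.
      apply Series_ext; intros n.
      apply (is_RInt_unique (V := R_CompleteNormedModule)).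
      apply (is_RInt_of_derive (fun x => b n * cos (om n * x)) (fun x => 1 * f n x)).
      - intros y. unfold f. auto_derive; auto. ring.
      - intros y. apply (continuous_mult (fun _ => 1) (f n)); auto.
        apply continuous_const. }
    rewrite <- E.
    rewrite (RInt_ext _ V) by (intros; unfold V; apply Rmult_1_l).
    apply (@RInt_correct R_CompleteNormedModule), ex_RInt_continuous; auto. }
  assert (HD : is_derive (fun x => F x - F 0) t (V t)).
  { apply (is_derive_RInt V (fun x => F x - F 0) 0 t); auto.
    exists (mkposreal 1 Rlt_0_1). intros; apply HI. }
  assert (HD' := is_derive_plus _ _ _ _ _ HD (is_derive_const (F 0) t)).
  rewrite plus_zero_r in HD'.
  eapply is_derive_ext with (2 := HD').
  intros x. unfold plus; simpl. unfold F. ring.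
Qed.

(** * First moments of products of sines *)

Lemma cos_sin_INR_PI (k : nat) : sin (INR k * PI) = 0 /\ cos (INR k * PI) = (-1) ^ k.
Proof.
  induction k as [|k [IHs IHc]].
  - simpl. rewrite Rmult_0_l, sin_0, cos_0. auto.
  - rewrite S_INR, Rmult_plus_distr_r, Rmult_1_l, sin_plus, cos_plus, IHs, IHc, cos_PI, sin_PI.
    simpl; split; ring.
Qed.

(** The primitive is explicit and is checked by differentiation. Boundary terms containing sin(k pi)
    vanish, which leaves x^2/4 at pi. *)
Lemma RInt_x_sin_sqr (k : nat) : (1 <= k)%nat ->
  RInt (fun x => x * sin (INR k * x) * sin (INR k * x)) 0 PI = PI ^ 2 / 4.
Proof.
  intros Hk.
  assert (Hk' : INR k <> 0) by (apply not_0_INR; lia).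
  destruct (cos_sin_INR_PI k) as [Hs Hc].
  set (w := INR k) in *.
  apply (is_RInt_unique (V := R_CompleteNormedModule)).
  assert (H : is_RInt (fun x => x * sin (w * x) * sin (w * x)) 0 PI
    ((PI ^ 2 / 4 - PI * sin (w * PI) * cos (w * PI) / (2 * w) + sin (w * PI) ^ 2 / (4 * w ^ 2))
     - (0 ^ 2 / 4 - 0 * sin (w * 0) * cos (w * 0) / (2 * w) + sin (w * 0) ^ 2 / (4 * w ^ 2)))).
  { apply (is_RInt_of_derive
      (fun x => x ^ 2 / 4 - x * sin (w * x) * cos (w * x) / (2 * w) + sin (w * x) ^ 2 / (4 * w ^ 2))).
    - intros x. auto_derive; auto.
      assert (E := sin2_cos2 (w * x)). unfold Rsqr in E.
      replace (cos (w * x) * cos (w * x)) with (1 - sin (w * x) * sin (w * x)) by lra.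
      field_simplify; auto.
      replace (cos (w * x) ^ 2) with (1 - sin (w * x) * sin (w * x)) by (simpl; lra).
      field; auto.
    - intros x; cont. }
  rewrite Hs, (Rmult_0_r w), sin_0 in H.
  match type of H with is_RInt _ _ _ ?l => replace (PI ^ 2 / 4) with l; auto end.
  field; auto.
Qed.

(** Product-to-sum gives the primitive [F]. Its sine terms vanish at both endpoints, and cos((j - k)
    pi) = cos((j + k) pi) = (-1)^j (-1)^k. *)
Lemma RInt_x_sin_sin (j k : nat) : (j <> k)%nat -> (1 <= k)%nat ->
  RInt (fun x => x * sin (INR j * x) * sin (INR k * x)) 0 PI =
  ((-1) ^ j * (-1) ^ k - 1) / 2 * (/ (INR j - INR k) ^ 2 - / (INR j + INR k) ^ 2).
Proof.
  intros Hjk Hk.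
  assert (HA : INR j - INR k <> 0) by (apply Rminus_eq_contra, not_INR; auto).
  assert (HB : INR j + INR k <> 0).
  { rewrite <- plus_INR. apply not_0_INR. lia. }
  destruct (cos_sin_INR_PI k) as [Hsk Hck]. destruct (cos_sin_INR_PI j) as [Hsj Hcj].
  set (u := INR j) in *. set (w := INR k) in *.
  apply (is_RInt_unique (V := R_CompleteNormedModule)).
  set (F := fun x => x * sin ((u - w) * x) / (2 * (u - w)) + cos ((u - w) * x) / (2 * (u - w) ^ 2)
                 - x * sin ((u + w) * x) / (2 * (u + w)) - cos ((u + w) * x) / (2 * (u + w) ^ 2)).
  assert (H : is_RInt (fun x => x * sin (u * x) * sin (w * x)) 0 PI (F PI - F 0)).
  { apply is_RInt_of_derive.
    - intros x. unfold F. auto_derive; auto.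
      rewrite (Rmult_minus_distr_r u w x), (Rmult_plus_distr_r u w x), sin_minus, sin_plus, cos_minus, cos_plus.
      field; auto.
    - intros x; cont. }
  match goal with |- is_RInt _ _ _ ?l => replace l with (F PI - F 0); auto end.
  unfold F. rewrite !Rmult_0_r, sin_0, cos_0, (Rmult_minus_distr_r u w PI), (Rmult_plus_distr_r u w PI),
    sin_minus, sin_plus, cos_minus, cos_plus, Hsk, Hsj, Hck, Hcj.
  field; auto.
Qed.

(** For even q and m >= 1 this is the integral of x sin(x) sin(q^m x) over [0, pi]. The value 0 at m
    = 0 keeps the pair (0, 0) from being counted beyond its diagonal term. *)
Definition cross_moment (q m : nat) : R :=
  match m with
  | O => 0
  | _ => / (INR q ^ m + 1) ^ 2 - / (INR q ^ m - 1) ^ 2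
  end.

Lemma INR_pow_ge_2 (q m : nat) : (2 <= q)%nat -> (1 <= m)%nat -> 2 <= INR q ^ m.
Proof.
  intros Hq Hm.
  assert (H2 : 2 <= INR q) by (change 2 with (INR 2); now apply le_INR).
  apply Rle_trans with (INR q ^ 1); [simpl; lra|]. apply Rle_pow; [lra|lia].
Qed.

Lemma pow_m1_even_pow (q n : nat) : Nat.Even q -> (1 <= n)%nat -> (-1) ^ (q ^ n) = 1.
Proof.
  intros [r Hr] Hn. destruct n as [|n]; [lia|].
  rewrite Nat.pow_succ_r', Hr, <- Nat.mul_assoc.
  apply pow_1_even.
Qed.

(* For even q the integral of x sin(jx) sin(kx) vanishes when j and k are distinct
   and of the same parity, so off the diagonal only the pairs involving q^0 = 1
   survive. *)
Lemma RInt_x_sin_sin_pow (q n m : nat) : (2 <= q)%nat -> Nat.Even q ->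
  RInt (fun x => x * sin (INR q ^ n * x) * sin (INR q ^ m * x)) 0 PI =
  (if (n =? m)%nat then PI ^ 2 / 4 else 0)
  + (if (n =? 0)%nat then cross_moment q m else 0)
  + (if (m =? 0)%nat then cross_moment q n else 0).
Proof.
  intros Hq He.
  rewrite <- !pow_INR.
  assert (Hpos : forall k, (1 <= q ^ k)%nat).
  { intros k. assert (H := Nat.pow_nonzero q k). lia. }
  assert (E : forall k, (1 <= k)%nat -> (2 <= q ^ k)%nat).
  { intros k Hk. apply INR_le. rewrite pow_INR. now apply INR_pow_ge_2. }
  destruct (Nat.eqb_spec n m) as [<-|Hnm].
  - rewrite RInt_x_sin_sqr by auto.
    destruct n; simpl; ring.
  - assert (Hne : (q ^ n <> q ^ m)%nat).
    { intros H. apply Nat.pow_inj_r in H; auto. }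
    rewrite RInt_x_sin_sin by auto.
    destruct n as [|n]; destruct m as [|m]; simpl Nat.eqb; cbv iota.
    + lia.
    + rewrite (pow_m1_even_pow q (S m)) by (auto; lia).
      assert (H := E (S m) ltac:(lia)). apply le_INR in H.
      unfold cross_moment. rewrite <- pow_INR. simpl (q ^ 0)%nat. simpl (INR 1).
      simpl (INR 2) in H. eqR. field. repeat split; lra.
    + rewrite pow_m1_even_pow by (auto; lia).
      assert (H := E (S n) ltac:(lia)). apply le_INR in H.
      unfold cross_moment. rewrite <- pow_INR. simpl (q ^ 0)%nat. simpl (INR 1).
      simpl (INR 2) in H. eqR. field. repeat split; lra.
    + rewrite !pow_m1_even_pow by (auto; lia). lra.
Qed.

Lemma cross_moment_abs_le (q m : nat) : (2 <= q)%nat -> Rabs (cross_moment q m) <= 1.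
Proof.
  intros Hq. destruct m as [|m]; [simpl; rewrite Rabs_R0; lra|].
  assert (H := INR_pow_ge_2 q (S m) Hq ltac:(lia)).
  unfold cross_moment. set (y := INR q ^ S m) in *.
  assert (H1 : 0 < / (y + 1) ^ 2 <= 1).
  { split; [apply Rinv_0_lt_compat; nra|]. rewrite <- Rinv_1. apply Rinv_le_contravar; nra. }
  assert (H2 : 0 < / (y - 1) ^ 2 <= 1).
  { split; [apply Rinv_0_lt_compat; nra|]. rewrite <- Rinv_1. apply Rinv_le_contravar; nra. }
  apply Rabs_le; lra.
Qed.

Lemma is_series_Rplus (a b : nat -> R) (la lb : R) :
  is_series a la -> is_series b lb -> is_series (fun n => a n + b n) (la + lb).
Proof. apply (is_series_plus a b la lb). Qed.

Lemma is_series_Rmult (c : R) (a : nat -> R) (la : R) :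
  is_series a la -> is_series (fun n => c * a n) (c * la).
Proof. apply (is_series_scal c a la). Qed.

Lemma is_series_indicator (n : nat) (w : R) :
  is_series (fun m => if (n =? m)%nat then w else 0) w.
Proof.
  apply filterlim_ext_loc with (fun _ => w); [|apply filterlim_const].
  exists n. intros N HN.
  rewrite sum_n_Reals.
  induction HN as [|N HN IH].
  - destruct n as [|n]; [reflexivity|].
    rewrite tech5, Nat.eqb_refl, sum_eq_R0; [ring|].
    intros k Hk. destruct (Nat.eqb_spec (S n) k); [lia|auto].
  - rewrite tech5, <- IH.
    destruct (Nat.eqb_spec n (S N)); [lia|ring].
Qed.

Lemma ex_series_geom_pow (r : R) : 0 <= r < 1 -> ex_series (fun n => r ^ n).
Proof. intros H. exists (/ (1 - r)). apply is_series_geom, Rabs_lt_between; lra. Qed.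

(** The two factors [F] are expanded one after the other, each time integrating termwise. The matrix
    of moments reduces to its diagonal, row 0 and column 0; the row and the column contribute
    equally, hence the factor 2. *)
Lemma RInt_x_sqr_sine_series (q : nat) (r : R) (u : nat -> R) :
  (2 <= q)%nat -> Nat.Even q -> 0 <= r < 1 -> (forall n, Rabs (u n) <= r ^ n) ->
  let F := fun x => Series (fun n => u n * sin (INR q ^ n * x)) in
  (forall x, continuous F x) /\
  RInt (fun x => x * F x ^ 2) 0 PI =
  PI ^ 2 / 4 * Series (fun n => u n ^ 2) + 2 * u 0%nat * Series (fun m => u m * cross_moment q m).
Proof.
  intros Hq He Hr Hu F.
  set (f := fun n x => u n * sin (INR q ^ n * x)).
  assert (HA := ex_series_geom_pow r Hr).
  assert (fA : forall n x, Rabs (f n x) <= r ^ n).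
  { intros n x. unfold f. eapply Rle_trans; [|apply Hu].
    apply Rabs_mult_le_bounded, Rabs_sin_le_1. }
  assert (fc : forall n x, continuous (f n) x) by (intros n x; unfold f; cont).
  assert (Fc : forall x, continuous F x).
  { intros x. now apply (continuous_normal_series f (fun n => r ^ n)). }
  split; auto.
  assert (idc : forall x : R, continuous (fun x : R => x) x) by (intros; apply continuous_id).
  assert (PIp := PI_RGT_0).
  assert (x_le : forall x, Rmin 0 PI <= x <= Rmax 0 PI -> Rabs x <= PI).
  { intros x. rewrite Rmin_left, Rmax_right by lra. intros; apply Rabs_le; lra. }
  assert (ones : forall n, r ^ n <= 1).
  { intros n. rewrite <- (pow1 n). apply pow_incr. lra. }
  assert (HuJ : ex_series (fun m => u m * cross_moment q m)).
  { apply ex_series_dominated with (2 := HA). intros n.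
    eapply Rle_trans; [|apply Hu].
    apply Rabs_mult_le_bounded, cross_moment_abs_le; auto. }
  assert (Hu2 : ex_series (fun n => u n ^ 2)).
  { apply ex_series_dominated with (2 := HA). intros n.
    eapply Rle_trans; [|apply Hu].
    simpl; rewrite Rmult_1_r. apply Rabs_mult_le_bounded.
    eapply Rle_trans; [apply Hu | apply ones]. }
  set (S1 := Series (fun m => u m * cross_moment q m)) in *.
  (* Row [n] of the double sum: its diagonal entry, the whole series [S1] when n = 0, and its entry
     in column 0. *)
  assert (Hin : forall n, RInt (fun x => x * F x * f n x) 0 PI =
     u n * (PI ^ 2 / 4 * u n + (if (n =? 0)%nat then S1 else 0) + u 0%nat * cross_moment q n)).
  { intros n.
    assert (HS := is_series_RInt_normal_series f (fun n => r ^ n) fA HA fc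
       (fun x => x * f n x) (fun x => continuous_mult (fun x => x) (f n) x (idc x) (fc n x))
       0 PI PI).
    rewrite (RInt_ext _ (fun x => x * f n x * Series (fun n => f n x)))
      by (intros x _; unfold F, f; eqR; ring).
    rewrite <- (is_series_unique _ _ (HS ltac:(
      intros x Hx; rewrite <- (Rmult_1_r PI), Rabs_mult;
      apply Rmult_le_compat; try apply Rabs_pos; auto;
      eapply Rle_trans; [apply fA | apply ones]))).
    clear HS.
    apply is_series_unique.
    eapply is_series_ext with
      (a := fun m => u n * (
          (if (n =? m)%nat then PI ^ 2 / 4 * u n else 0)
          + (if (n =? 0)%nat then u m * cross_moment q m else 0)
          + (if (0 =? m)%nat then u 0%nat * cross_moment q n else 0))).
    - intros m.
      rewrite (RInt_ext _ (fun x => scal (u n * u m)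
                 (x * sin (INR q ^ n * x) * sin (INR q ^ m * x)))).
      2: { intros x _. unfold f. unfold scal; simpl; unfold mult; simpl; eqR; ring. }
      rewrite (@RInt_scal R_CompleteNormedModule).
      2: { apply (@ex_RInt_continuous R_CompleteNormedModule). intros z _; cont. }
      rewrite RInt_x_sin_sin_pow by auto.
      rewrite (Nat.eqb_sym 0 m).
      unfold scal, plus; simpl; unfold mult; simpl.
      destruct (Nat.eqb_spec n m) as [->|]; destruct (Nat.eqb_spec m 0) as [->|];
      try (destruct (Nat.eqb_spec n 0) as [->|]); simpl; eqR; ring.
    - apply is_series_Rmult.
      apply is_series_Rplus; [apply is_series_Rplus|]; try apply is_series_indicator.
      destruct (n =? 0)%nat.
      + now apply Series_correct.
      (* For n > 0 this summand is the zero series, presented as an indicator of value 0. *)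
      + apply is_series_ext with (fun k => if (0 =? k)%nat then 0 else 0).
        { intros k; destruct k; auto. }
        apply is_series_indicator. }
  assert (gc : forall x, continuous (fun x => x * F x) x).
  { intros x; apply (continuous_mult (fun x => x) F); auto. }
  (* The rows are now summed, with the weight x F(x), which is bounded on [0, pi] by pi times the
     geometric sum. *)
  assert (HS := is_series_RInt_normal_series f (fun n => r ^ n) fA HA fc
       (fun x => x * F x) gc 0 PI (PI * Series (fun n => r ^ n))).
  rewrite (RInt_ext _ (fun x => x * F x * Series (fun n => f n x)))
      by (intros x _; unfold F, f; eqR; ring).
  rewrite <- (is_series_unique _ _ (HS ltac:(
      intros x Hx; cbv beta; rewrite Rabs_mult; apply Rmult_le_compat; try apply Rabs_pos; auto;
      apply (Series_dominated (fun n => f n x)); auto))).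
  clear HS.
  apply is_series_unique.
  apply is_series_ext with
    (fun n => PI ^ 2 / 4 * u n ^ 2 + (if (0 =? n)%nat then u 0%nat * S1 else 0)
              + u 0%nat * (u n * cross_moment q n)).
  - intros n. rewrite Hin, (Nat.eqb_sym 0 n).
    unfold scal, plus; simpl; unfold mult; simpl.
    destruct (Nat.eqb_spec n 0) as [->|]; simpl; eqR; ring.
  - replace (PI ^ 2 / 4 * Series (fun n => u n ^ 2) + 2 * u 0%nat * S1) with
      (PI ^ 2 / 4 * Series (fun n => u n ^ 2) + u 0%nat * S1 + u 0%nat * S1) by ring.
    apply is_series_Rplus; [apply is_series_Rplus|].
    + apply is_series_Rmult, Series_correct; auto.
    + apply is_series_indicator.
    + apply is_series_Rmult, Series_correct; auto.
Qed.

(** * The velocity as a lacunary sine series *)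

(** With y = q^m, [cross_moment] equals -4y / (y^2 - 1)^2, so differentiating a cosine of frequency
    y^2 - 1 cancels one factor of the denominator. At m = 0 the frequency is 0 and nothing
    remains. *)
Definition velocity_coef (q : nat) (s : R) (m : nat) : R :=
  match m with
  | O => 0
  | _ => 8 * Nnorm q s ^ 2 * (Rpower (INR q) (s - 2) ^ m * INR q ^ m) / ((INR q ^ 2) ^ m - 1)
  end.

Definition velocity (q : nat) (s t : R) : R :=
  Series (fun m => velocity_coef q s m * sin (((INR q ^ 2) ^ m - 1) * t)).

Lemma INR_ge_2 (q : nat) : (2 <= q)%nat -> 2 <= INR q.
Proof. intros Hq. change 2 with (INR 2). now apply le_INR. Qed.

Lemma Rpower_lt_1 (x y : R) : 1 < x -> y < 0 -> 0 < Rpower x y < 1.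
Proof.
  intros Hx Hy. split; [apply exp_pos|].
  rewrite <- (Rpower_O x) by lra. apply Rpower_lt; auto.
Qed.

Lemma coefW_pow (q : nat) (s : R) (n : nat) :
  coefW q s n = Rpower (INR q) (s - 2) ^ n.
Proof.
  unfold coefW. rewrite <- Rpower_pow by apply exp_pos.
  rewrite Rpower_mult. f_equal; ring.
Qed.

(** The moment formula is applied to the real and the imaginary part. In the diagonal sums cos^2 +
    sin^2 = 1 removes the time; in the cross terms the addition formula for cos(A - B) produces the
    frequencies q^(2m) - 1. *)
Lemma avg_x_series (q : nat) (s t : R) :
  (2 <= q)%nat -> Nat.Even q -> 0 < s < 2 ->
  avg_x q s t =
  Nnorm q s ^ 2 * (PI ^ 2 / 4) * Series (fun n => (Rpower (INR q) (s - 2) ^ n) ^ 2)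
  + Series (fun m => 2 * Nnorm q s ^ 2 * Rpower (INR q) (s - 2) ^ m * cross_moment q m
                     * cos (((INR q ^ 2) ^ m - 1) * t)).
Proof.
  intros Hq He Hs.
  assert (Hq2 := INR_ge_2 q Hq).
  set (r := Rpower (INR q) (s - 2)).
  assert (Hr : 0 < r < 1) by (apply Rpower_lt_1; lra).
  set (N := Nnorm q s).
  set (u := fun n => r ^ n * cos (INR q ^ (2 * n) * t)).
  set (w := fun n => r ^ n * sin (INR q ^ (2 * n) * t)).
  assert (rn : forall n, Rabs (r ^ n) = r ^ n).
  { intros n. apply Rabs_pos_eq, pow_le; lra. }
  assert (Hu : forall n, Rabs (u n) <= r ^ n).
  { intros n. rewrite <- (rn n). apply Rabs_mult_le_bounded, Rabs_cos_le_1. }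
  assert (Hw : forall n, Rabs (w n) <= r ^ n).
  { intros n. rewrite <- (rn n). apply Rabs_mult_le_bounded, Rabs_sin_le_1. }
  assert (Hr' : 0 <= r < 1) by lra.
  assert (HA := ex_series_geom_pow r Hr').
  destruct (RInt_x_sqr_sine_series q r u Hq He Hr' Hu) as [Fc FI].
  destruct (RInt_x_sqr_sine_series q r w Hq He Hr' Hw) as [Gc GI].
  set (F := fun x => Series (fun n => u n * sin (INR q ^ n * x))) in *.
  set (G := fun x => Series (fun n => w n * sin (INR q ^ n * x))) in *.
  (* The minus sign of [ImPsi] disappears on squaring. *)
  assert (HP : forall x, Pdens q s x t = N ^ 2 * (F x ^ 2 + G x ^ 2)).
  { intros x. unfold Pdens, RePsi, ImPsi. fold N.
    rewrite (Series_ext _ (fun n => u n * sin (INR q ^ n * x))).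
    2: intros n; rewrite coefW_pow; fold r; unfold u; ring.
    fold (F x).
    rewrite (Series_ext _ (fun n => w n * sin (INR q ^ n * x))).
    2: intros n; rewrite coefW_pow; fold r; unfold w; ring.
    fold (G x). ring. }
  assert (cx : forall H : R -> R, (forall x, continuous H x) ->
             ex_RInt (fun x => x * H x ^ 2) 0 PI).
  { intros H Hc. apply (@ex_RInt_continuous R_CompleteNormedModule). intros z _.
    apply (continuous_mult (fun x => x) (fun x => H x ^ 2)); [apply continuous_id|].
    apply (continuous_ext (fun x => mult (H x) (H x))).
    { intros; unfold mult; simpl; eqR; ring. }
    apply (continuous_mult H H); auto. }
  unfold avg_x.
  rewrite (RInt_ext _ (fun x => scal (N ^ 2) (plus (x * F x ^ 2) (x * G x ^ 2)))).
  2: { intros x _. rewrite HP. unfold scal, plus; simpl; unfold mult; simpl; eqR; ring. }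
  rewrite (@RInt_scal R_CompleteNormedModule).
  2: { apply (@ex_RInt_plus R_NormedModule); auto. }
  rewrite (@RInt_plus R_CompleteNormedModule) by auto.
  rewrite (FI : RInt (fun x => x * F x ^ 2) 0 PI = _), (GI : RInt (fun x => x * G x ^ 2) 0 PI = _).
  unfold scal, plus; simpl (AbelianMonoid.sort _).
  change (N ^ 2 * ((PI ^ 2 / 4 * Series (fun n => u n ^ 2)
                    + 2 * u 0%nat * Series (fun m => u m * cross_moment q m))
                 + (PI ^ 2 / 4 * Series (fun n => w n ^ 2)
                    + 2 * w 0%nat * Series (fun m => w m * cross_moment q m)))
          = N ^ 2 * (PI ^ 2 / 4) * Series (fun n => (r ^ n) ^ 2)
  + Series (fun m => 2 * N ^ 2 * r ^ m * cross_moment q m * cos (((INR q ^ 2) ^ m - 1) * t))).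
  assert (ones : forall n, r ^ n <= 1).
  { intros n. rewrite <- (pow1 n). apply pow_incr. lra. }
  assert (sq : forall z : nat -> R, (forall n, Rabs (z n) <= r ^ n) -> ex_series (fun n => z n ^ 2)).
  { intros z Hz. apply ex_series_dominated with (2 := HA). intros n.
    eapply Rle_trans; [|apply Hz].
    simpl; rewrite Rmult_1_r. apply Rabs_mult_le_bounded.
    eapply Rle_trans; [apply Hz | apply ones]. }
  assert (cr : forall z : nat -> R, (forall n, Rabs (z n) <= r ^ n) ->
             ex_series (fun n => z n * cross_moment q n)).
  { intros z Hz. apply ex_series_dominated with (2 := HA). intros n.
    eapply Rle_trans; [|apply Hz].
    apply Rabs_mult_le_bounded, cross_moment_abs_le; auto. }
  replace (Series (fun n => (r ^ n) ^ 2))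
    with (Series (fun n => u n ^ 2) + Series (fun n => w n ^ 2)).
  2: { rewrite <- Series_plus by auto. apply Series_ext. intros n. unfold u, w.
       assert (E := sin2_cos2 (INR q ^ (2 * n) * t)). unfold Rsqr in E.
       replace (_ + _) with ((r ^ n) ^ 2 * (sin (INR q ^ (2 * n) * t) * sin (INR q ^ (2 * n) * t)
          + cos (INR q ^ (2 * n) * t) * cos (INR q ^ (2 * n) * t))) by ring.
       rewrite E; ring. }
  replace (Series (fun m => 2 * N ^ 2 * r ^ m * cross_moment q m * cos (((INR q ^ 2) ^ m - 1) * t)))
   with (2 * N ^ 2 * u 0%nat * Series (fun m => u m * cross_moment q m)
         + 2 * N ^ 2 * w 0%nat * Series (fun m => w m * cross_moment q m)).
  2: { rewrite <- !Series_scal_l, <- Series_plus.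
       2, 3: apply (ex_series_scal_l (K := R_AbsRing) (V := R_NormedModule)); auto.
       apply Series_ext; intros m. unfold u, w.
       rewrite Nat.mul_0_r, !pow_O, Rmult_minus_distr_r, !Rmult_1_l, cos_minus, <- pow_mult.
       ring. }
  ring.
Qed.

(** Here r = q^(s - 3). With Y = q^(2m) >= 2 the quotient Y / (Y - 1) is at most 2, which turns the
    leading constant 8 into 16. *)
Lemma velocity_coef_bounds (q : nat) (s : R) :
  (2 <= q)%nat -> 0 < s < 2 ->
  let r := Rpower (INR q) (s - 2) * INR q / INR q ^ 2 in
  0 < r < 1 /\
  forall m, 0 <= velocity_coef q s m <= 16 * Nnorm q s ^ 2 * r ^ m.
Proof.
  intros Hq Hs r.
  assert (Hq2 := INR_ge_2 q Hq).
  assert (Hr : 0 < Rpower (INR q) (s - 2) < 1) by (apply Rpower_lt_1; lra).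
  assert (Er : r = Rpower (INR q) (s - 2) / INR q) by (unfold r; field; lra).
  split.
  { rewrite Er. split; [apply Rdiv_lt_0_compat; lra|].
    apply Rlt_div_l; lra. }
  assert (Hr0 : 0 < r) by (rewrite Er; apply Rdiv_lt_0_compat; lra).
  assert (HN : 0 <= Nnorm q s ^ 2) by apply pow2_ge_0.
  intros [|m].
  { simpl (velocity_coef q s 0). simpl (r ^ 0). lra. }
  unfold velocity_coef.
  assert (H4 : 2 <= (INR q ^ 2) ^ S m).
  { rewrite <- pow_mult. apply INR_pow_ge_2; auto; lia. }
  set (Y := (INR q ^ 2) ^ S m) in *.
  set (X := Rpower (INR q) (s - 2) ^ S m * INR q ^ S m).
  assert (HX : 0 < X) by (apply Rmult_lt_0_compat; apply pow_lt; lra).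
  assert (E : r ^ S m = X / Y).
  { unfold r, X, Y. rewrite Rdiv_def, !Rpow_mult_distr, pow_inv. reflexivity. }
  rewrite E.
  assert (HNX := Rmult_le_pos _ _ HN (Rlt_le _ _ HX)).
  split.
  - apply Rmult_le_pos; [lra|]. left; apply Rinv_0_lt_compat; lra.
  - apply Rle_div_l; [lra|].
    replace (16 * Nnorm q s ^ 2 * (X / Y) * (Y - 1))
      with (8 * (Nnorm q s ^ 2 * X) * (2 - 2 / Y)) by (field; lra).
    assert (/ Y <= / 2) by (apply Rinv_le_contravar; lra).
    apply Rle_trans with (8 * (Nnorm q s ^ 2 * X) * 1); [lra|].
    apply Rmult_le_compat_l; lra.
Qed.

(** The time-independent part drops out and the cosine series is differentiated termwise. Its
    coefficients are dominated by powers of q^(s - 2), those of the derived series by powers of q^(s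
    - 3). *)
Lemma is_derive_avg_x (q : nat) (s t : R) :
  (2 <= q)%nat -> Nat.Even q -> 0 < s < 2 -> is_derive (avg_x q s) t (velocity q s t).
Proof.
  intros Hq He Hs.
  assert (Hq2 := INR_ge_2 q Hq).
  set (r := Rpower (INR q) (s - 2)).
  assert (Hr : 0 < r < 1) by (apply Rpower_lt_1; lra).
  set (N := Nnorm q s).
  set (b := fun m => 2 * N ^ 2 * r ^ m * cross_moment q m).
  set (om := fun m => (INR q ^ 2) ^ m - 1).
  assert (Hc : forall m, - (b m * om m) = velocity_coef q s m).
  { intros [|m].
    - unfold b, om; simpl; ring.
    - unfold b, om, velocity_coef, cross_moment. fold N; fold r.
      assert (H := INR_pow_ge_2 q (S m) Hq ltac:(lia)).
      rewrite <- pow_mult, Nat.mul_comm, pow_mult.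
      set (y := INR q ^ S m) in *. field. nra. }
  destruct (velocity_coef_bounds q s Hq Hs) as [Hp Ha].
  assert (Hbn : forall m, Rabs (b m) <= 2 * N ^ 2 * r ^ m).
  { intros m. unfold b.
    eapply Rle_trans; [apply Rabs_mult_le_bounded, cross_moment_abs_le; auto|].
    right. apply Rabs_pos_eq. assert (H1 := pow2_ge_0 N).
    assert (H2 : 0 < r ^ m) by (apply pow_lt; lra). nra. }
  assert (D := is_derive_cos_series b om t).
  eapply is_derive_ext.
  { intros x; symmetry; apply (avg_x_series q s x Hq He Hs). }
  fold r N.
  set (c := N ^ 2 * (PI ^ 2 / 4) * _).
  rewrite <- (plus_zero_l (velocity q s t)).
  apply (is_derive_plus (fun _ => c)).
  { apply (@is_derive_const R_AbsRing R_NormedModule). }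
  unfold velocity.
  rewrite (Series_ext _ (fun n => - (b n * om n) * sin (om n * t))).
  2: intros n; now rewrite Hc.
  apply D.
  - apply ex_series_dominated with (A := fun m => 2 * N ^ 2 * r ^ m).
    + intros n; rewrite Rabs_Rabsolu; auto.
    + apply (ex_series_scal_l (K := R_AbsRing) (V := R_NormedModule)).
      apply ex_series_geom_pow; lra.
  - eapply ex_series_dominated with (A := fun m => 16 * N ^ 2 * _ ^ m).
    + intros n; rewrite Rabs_Rabsolu, <- Rabs_Ropp, Hc.
      rewrite Rabs_pos_eq; apply Ha.
    + apply (ex_series_scal_l (K := R_AbsRing) (V := R_NormedModule)).
      apply ex_series_geom_pow; lra.
Qed.


(** * Counting grid squares column by column *)

Fixpoint zrange (z : Z) (n : nat) : list Z :=
  match n with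
  | O => nil
  | S n => z :: zrange (z + 1) n
  end.

Lemma in_zrange (n : nat) : forall z i : Z, In i (zrange z n) <-> (z <= i < z + Z.of_nat n)%Z.
Proof.
  induction n as [|n IH]; intros z i; simpl; [lia|]. rewrite IH. lia.
Qed.

Lemma NoDup_zrange (n : nat) : forall z, NoDup (zrange z n).
Proof.
  induction n as [|n IH]; intros z; simpl; constructor; auto. rewrite in_zrange. lia.
Qed.

Lemma length_zrange (n : nat) : forall z, length (zrange z n) = n.
Proof. induction n as [|n IH]; intros z; simpl; auto. Qed.

Lemma floor_exists (r : R) : exists z : Z, IZR z <= r < IZR z + 1.
Proof.
  exists (up r - 1)%Z. rewrite minus_IZR. destruct (archimed r). lra.
Qed.


Definition stack (col : Z -> list Z) (l : list Z) : list (Z * Z) :=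
  flat_map (fun i => map (pair i) (col i)) l.

Lemma in_stack (col : Z -> list Z) (l : list Z) (i j : Z) :
  In (i, j) (stack col l) <-> In i l /\ In j (col i).
Proof.
  unfold stack. rewrite in_flat_map. split.
  - intros [x [Hx H]]. apply in_map_iff in H. destruct H as [y [E Hy]].
    injection E; intros; subst; auto.
  - intros [H1 H2]. exists i; split; auto. now apply in_map.
Qed.

Lemma NoDup_stack (col : Z -> list Z) (l : list Z) :
  (forall i, NoDup (col i)) -> NoDup l -> NoDup (stack col l).
Proof.
  intros Hc Hl. induction Hl as [|x l Hx Hl IH]; simpl; [constructor|].
  apply NoDup_app; auto.
  - apply NoDup_map_NoDup_ForallPairs; auto. intros u v _ _ E; congruence.
  - intros [i j] H1 H2. apply in_stack in H2.
    apply in_map_iff in H1. destruct H1 as [y [E _]].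
    injection E; intros; subst. tauto.
Qed.

Lemma length_stack_cons (col : Z -> list Z) (z : Z) (l : list Z) :
  length (stack col (z :: l)) = (length (col z) + length (stack col l))%nat.
Proof. simpl. rewrite length_app, length_map. reflexivity. Qed.

Lemma INR_length_stack_le (col : Z -> list Z) (l : list Z) (K : R) :
  (forall i, INR (length (col i)) <= K) -> INR (length (stack col l)) <= INR (length l) * K.
Proof.
  intros H. induction l as [|z l IH]; [simpl; lra|].
  rewrite length_stack_cons, plus_INR. simpl (length (z :: l)). rewrite S_INR.
  specialize (H z). lra.
Qed.

Section GraphCount.

Variables (f : R -> R) (a b d M : R).
Hypothesis f_cont : forall t, continuous f t.
Hypothesis f_bound : forall t, Rabs (f t) <= M.
Hypothesis a_lt_b : a < b.
Hypothesis d_pos : 0 < d.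

Let meets := meets_square (graph_on f a b) d.

Lemma meets_square_graph (i j : Z) :
  meets i j <->
  exists t, a <= t <= b /\ IZR i * d <= t <= (IZR i + 1) * d
            /\ IZR j * d <= f t <= (IZR j + 1) * d.
Proof.
  unfold meets, meets_square, graph_on. split.
  - intros [[t y] [[H1 H2] [H3 H4]]]. simpl in *. subst y. exists t; auto.
  - intros [t [H1 [H2 H3]]]. exists (t, f t); simpl; auto.
Qed.

(** The bound [M] on f confines the rows met in any column to a fixed finite range, which is then
    filtered by classical decidability of meeting. *)
Lemma finite_columns :
  exists col : Z -> list Z, forall i, NoDup (col i) /\ forall j, In j (col i) <-> meets i j.
Proof.
  destruct (floor_exists (M / d)) as [K HK].
  assert (M0 : 0 <= M) by (eapply Rle_trans; [apply Rabs_pos | apply (f_bound 0)]).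
  exists (fun i => filter (fun j => if excluded_middle_informative (meets i j) then true else false)
                    (zrange (- K - 3) (Z.to_nat (2 * K + 7)))).
  intros i. split; [apply NoDup_filter, NoDup_zrange|].
  intros j. rewrite filter_In, in_zrange.
  destruct (excluded_middle_informative (meets i j)) as [H|H]; split; intros H'; auto; try easy.
  split; auto.
  apply meets_square_graph in H. destruct H as [t [_ [_ H]]].
  assert (Hb := f_bound t). apply Rabs_le_between in Hb.
  assert (HM : M < (IZR K + 1) * d) by (apply Rlt_div_l; lra).
  assert (H1 : IZR j < IZR K + 1) by (apply Rmult_lt_reg_r with d; lra).
  assert (H2 : - (IZR K + 1) < IZR j + 1) by (apply Rmult_lt_reg_r with d; lra).
  rewrite <- plus_IZR in H1. rewrite <- !plus_IZR, <- opp_IZR in H2.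
  apply lt_IZR in H1. apply lt_IZR in H2.
  assert (0 <= K)%Z.
  { assert (0 < IZR K + 1) by (apply Rle_lt_trans with (M / d); [apply Rdiv_le_0_compat|]; lra).
    rewrite <- plus_IZR in H0. apply lt_IZR in H0. lia. }
  lia.
Qed.

(** By the intermediate value theorem the graph between the two points meets every square of the
    column from the row of one value to the row of the other. Taking t = u shows that the column is
    occupied. *)
Lemma column_length_lower (i : Z) (l : list Z) (t u : R) :
  (forall j, In j l <-> meets i j) ->
  a <= t <= b -> a <= u <= b ->
  IZR i * d <= t <= (IZR i + 1) * d -> IZR i * d <= u <= (IZR i + 1) * d ->
  1 <= INR (length l) /\ Rabs (f t - f u) <= d * INR (length l).
Proof.
  intros Hl.
  assert (wlog : forall t u, a <= t <= b -> a <= u <= b ->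
    IZR i * d <= t <= (IZR i + 1) * d -> IZR i * d <= u <= (IZR i + 1) * d ->
    f t <= f u -> 1 <= INR (length l) /\ f u - f t <= d * INR (length l)).
  { clear t u. intros t u Ht Hu Hti Hui Hle.
    destruct (floor_exists (f t / d)) as [z1 [A1 B1]].
    destruct (floor_exists (f u / d)) as [z2 [A2 B2]].
    apply Rle_div_r in A1; auto. apply Rlt_div_l in B1; auto.
    apply Rle_div_r in A2; auto. apply Rlt_div_l in B2; auto.
    assert (Hz : (z1 <= z2)%Z).
    { assert (IZR z1 < IZR z2 + 1) by (apply Rmult_lt_reg_r with d; lra).
      rewrite <- plus_IZR in H. apply lt_IZR in H. lia. }
    set (n := Z.to_nat (z2 - z1 + 1)).
    assert (Hn : INR n = IZR z2 - IZR z1 + 1).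
    { unfold n. rewrite INR_IZR_INZ, Z2Nat.id by lia. rewrite plus_IZR, minus_IZR. ring. }
    assert (Hlen : (n <= length l)%nat).
    { rewrite <- (length_zrange n z1). apply NoDup_incl_length; [apply NoDup_zrange|].
      intros z Hzr. apply in_zrange in Hzr. unfold n in Hzr. rewrite Z2Nat.id in Hzr by lia.
      apply Hl, meets_square_graph.
      (* The lowest row is met at [t] itself, since its bottom edge may lie below f(t). The bottom
         edge of every other row is a value taken between [t] and [u]. *)
      destruct (Z.eq_dec z z1) as [->|Hne].
      - exists t. repeat split; lra.
      - assert (C1 : IZR z1 + 1 <= IZR z) by (rewrite <- plus_IZR; apply IZR_le; lia).
        assert (C2 : IZR z <= IZR z2) by (apply IZR_le; lia).
        apply Rmult_le_compat_r with (r := d) in C1; [|lra].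
        apply Rmult_le_compat_r with (r := d) in C2; [|lra].
        destruct (IVT_gen f t u (IZR z * d)) as [x [Hx E]].
        + intros x. apply continuity_pt_filterlim, f_cont.
        + rewrite Rmin_left, Rmax_right by lra. lra.
        + exists x. rewrite E.
          assert (Hm : Rmin t u = t \/ Rmin t u = u) by (apply Rmin_case; auto).
          assert (HM : Rmax t u = t \/ Rmax t u = u) by (apply Rmax_case; auto).
          destruct Hm as [Hm|Hm]; destruct HM as [HM|HM]; rewrite Hm, HM in Hx;
            repeat split; lra. }
    apply le_INR in Hlen. apply IZR_le in Hz.
    split; [lra|].
    apply Rle_trans with (d * INR n); [|apply Rmult_le_compat_l; lra].
    rewrite Hn. lra. }
  intros Ht Hu Hti Hui.
  destruct (Rle_dec (f t) (f u)) as [H|H].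
  - rewrite Rabs_minus_sym, Rabs_pos_eq by lra. auto.
  - rewrite Rabs_pos_eq by lra. apply wlog; auto; lra.
Qed.

(** Two points of one column are at distance at most [d], so all occupied rows lie within K + 1 of
    any fixed occupied row, where K is the integer part of w / d. The additive 5 covers rounding and
    the empty column. *)
Lemma column_length_upper (i : Z) (l : list Z) (w : R) :
  NoDup l -> (forall j, In j l <-> meets i j) -> 0 <= w ->
  (forall t u, a <= t <= b -> a <= u <= b -> Rabs (t - u) <= d -> Rabs (f t - f u) <= w) ->
  INR (length l) <= 2 * (w / d) + 5.
Proof.
  intros Hnd Hl Hw Hosc.
  assert (Hwd : 0 <= w / d) by (apply Rdiv_le_0_compat; lra).
  destruct l as [|j0 l']; [simpl; lra|].
  set (l := j0 :: l') in *.
  destruct (floor_exists (w / d)) as [K HK].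
  assert (K0 : (0 <= K)%Z).
  { assert (0 < IZR (K + 1)) by (rewrite plus_IZR; lra). apply lt_IZR in H. lia. }
  assert (Hj0 : meets i j0) by (apply Hl; left; auto).
  apply meets_square_graph in Hj0. destruct Hj0 as [t0 [T1 [T2 T3]]].
  assert (Hlen : (length l <= Z.to_nat (2 * K + 5))%nat).
  { rewrite <- (length_zrange (Z.to_nat (2 * K + 5)) (j0 - K - 2)).
    apply NoDup_incl_length; auto.
    intros j Hj. apply in_zrange. rewrite Z2Nat.id by lia.
    apply Hl, meets_square_graph in Hj. destruct Hj as [t [U1 [U2 U3]]].
    assert (Ho : Rabs (f t - f t0) <= w) by (apply Hosc; auto; apply Rabs_le; lra).
    apply Rabs_le_between in Ho.
    assert (Hw' : w < (IZR K + 1) * d) by (apply Rlt_div_l; lra).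
    assert (H1 : IZR j < IZR j0 + 1 + (IZR K + 1)) by (apply Rmult_lt_reg_r with d; lra).
    assert (H2 : IZR j0 < IZR j + 1 + (IZR K + 1)) by (apply Rmult_lt_reg_r with d; lra).
    rewrite <- !plus_IZR in H1, H2. apply lt_IZR in H1. apply lt_IZR in H2. lia. }
  apply le_INR in Hlen.
  rewrite (INR_IZR_INZ (Z.to_nat _)), Z2Nat.id, plus_IZR, mult_IZR in Hlen by lia.
  lra.
Qed.

Lemma continuous_shift_diff_mult (h : R) (psi : R -> R) (t : R) :
  (forall t, continuous psi t) -> continuous (fun t => (f t - f (t + h)) * psi t) t.
Proof.
  intros Hpsi.
  apply (continuous_mult (fun t => f t - f (t + h)) psi); auto.
  apply (continuous_minus f (fun t => f (t + h))); auto.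
  apply (continuous_comp (fun t => t + h) f); auto.
  apply (continuous_plus (fun t => t) (fun _ => h)); [apply continuous_id | apply continuous_const].
Qed.

(** For t in column z the point t + h lies in column z or z + 1, so the difference is at most d
    times the number of squares in these two columns. Integration over the width d gives d^2, and
    the columns are added up by induction. The spare column before [b] makes room for the shift. *)
Lemma RInt_shift_diff_le (col : Z -> list Z) (h : R) (psi : R -> R) :
  (forall i j, In j (col i) <-> meets i j) ->
  0 <= h <= d -> (forall t, continuous psi t) -> (forall t, Rabs (psi t) <= 1) ->
  forall (n : nat) (z : Z), a <= IZR z * d -> (IZR z + INR n + 1) * d <= b ->
  RInt (fun t => (f t - f (t + h)) * psi t) (IZR z * d) ((IZR z + INR n) * d)
  <= d ^ 2 * (INR (length (stack col (zrange z n)))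
              + INR (length (stack col (zrange (z + 1) n)))).
Proof.
  intros Hcol Hh Hpsi Hpsi1 n.
  assert (Hex : forall x y, ex_RInt (fun t => (f t - f (t + h)) * psi t) x y).
  { intros x y. apply (@ex_RInt_continuous R_CompleteNormedModule). intros t _.
    now apply continuous_shift_diff_mult. }
  induction n as [|n IH]; intros z Ha Hb.
  - simpl. rewrite Rplus_0_r, RInt_point. unfold zero; simpl. lra.
  - rewrite S_INR in *. simpl zrange. rewrite !length_stack_cons, !plus_INR.
    rewrite <- (RInt_Chasles _ _ (IZR (z + 1) * d)) by apply Hex.
    assert (IH' := IH (z + 1)%Z).
    assert (Hn := pos_INR n). assert (Hnd := Rmult_le_pos _ _ Hn (Rlt_le _ _ d_pos)).
    rewrite plus_IZR in IH' |- *.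
    replace (IZR z + 1 + INR n) with (IZR z + (INR n + 1)) in IH' by ring.
    specialize (IH' ltac:(lra) ltac:(lra)).
    set (X := RInt _ (IZR z * d) _). set (Y := RInt _ _ ((IZR z + (INR n + 1)) * d)) in *.
    change (plus X Y) with (X + Y).
    assert (HX : X <= d ^ 2 * (INR (length (col z)) + INR (length (col (z + 1)%Z)))).
    { apply Rle_trans with (RInt (fun _ => d * (INR (length (col z)) + INR (length (col (z + 1)%Z))))
                              (IZR z * d) ((IZR z + 1) * d)).
      - apply RInt_le; auto; [lra| apply ex_RInt_const |].
        intros t Ht.
        apply Rle_trans with (1 := Rle_abs _).
        rewrite Rabs_mult.
        apply Rle_trans with (Rabs (f t - f (t + h)) * 1).
        { apply Rmult_le_compat_l; auto. apply Rabs_pos. }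
        rewrite Rmult_1_r.
        assert (Hc0 := column_length_lower z (col z) t).
        assert (Hc1 := column_length_lower (z + 1) (col (z + 1)%Z) ((IZR z + 1) * d) (t + h)).
        rewrite !plus_IZR in Hc1.
        assert (P1 := pos_INR (length (col (z + 1)%Z))).
        (* When t + h passes the common edge, the difference is split at the value on the edge and
           each half is charged to its own column. *)
        destruct (Rle_dec (t + h) ((IZR z + 1) * d)) as [Hth|Hth].
        + destruct (Hc0 (t + h)) as [_ Hc]; auto; try lra.
          assert (Hq := Rmult_le_pos _ _ (Rlt_le _ _ d_pos) P1). lra.
        + destruct (Hc0 ((IZR z + 1) * d)) as [_ Hca]; auto; try lra.
          destruct Hc1 as [_ Hcb]; auto; try lra.
          replace (f t - f (t + h)) with ((f t - f ((IZR z + 1) * d))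
                     + (f ((IZR z + 1) * d) - f (t + h))) by ring.
          eapply Rle_trans; [apply Rabs_triang|]. lra.
      - rewrite RInt_const. unfold scal; simpl; unfold mult; simpl. right; ring. }
    lra.
Qed.

(** Collects for a single count N all that the dimension proof uses: an upper bound from the
    oscillation, one square per column, and the test integral bound, whose factor 2 comes from the
    two shifted families of columns. *)
Lemma graph_box_count :
  exists N : nat, box_count (graph_on f a b) d N /\
  (forall w, 0 <= w ->
    (forall t u, a <= t <= b -> a <= u <= b -> Rabs (t - u) <= d -> Rabs (f t - f u) <= w) ->
    INR N <= ((b - a) / d + 3) * (2 * (w / d) + 5)) /\
  (b - a) / d <= INR N /\
  (forall (h : R) (psi : R -> R) (n : nat) (z : Z),
    0 <= h <= d -> (forall t, continuous psi t) -> (forall t, Rabs (psi t) <= 1) ->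
    a <= IZR z * d -> (IZR z + INR n + 1) * d <= b ->
    RInt (fun t => (f t - f (t + h)) * psi t) (IZR z * d) ((IZR z + INR n) * d)
    <= 2 * d ^ 2 * INR N).
Proof.
  destruct finite_columns as [col Hcol].
  assert (Hc1 : forall i, NoDup (col i)) by (intros; apply Hcol).
  assert (Hc2 : forall i j, In j (col i) <-> meets i j) by (intros; apply Hcol).
  destruct (floor_exists (a / d)) as [za [A1 A2]].
  destruct (floor_exists (b / d)) as [zb [B1 B2]].
  assert (Hab : a / d < b / d).
  { apply Rmult_lt_compat_r; auto. now apply Rinv_0_lt_compat. }
  assert (Hzz : (za <= zb)%Z).
  { assert (IZR za < IZR (zb + 1)) by (rewrite plus_IZR; lra). apply lt_IZR in H. lia. }
  apply Rle_div_r in A1; auto. apply Rlt_div_l in A2; auto.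
  apply Rle_div_r in B1; auto. apply Rlt_div_l in B2; auto.
  (* Squares are closed, so column za - 1 is met when [a] lies on a grid line; the columns run from
     za - 1 to zb. *)
  set (n0 := Z.to_nat (zb - za + 2)).
  set (l := stack col (zrange (za - 1) n0)).
  assert (Hl : forall i j, In (i, j) l <-> meets i j).
  { intros i j. unfold l. rewrite in_stack, Hc2, in_zrange. split; [tauto|].
    intros H; split; auto. unfold n0. rewrite Z2Nat.id by lia.
    apply meets_square_graph in H. destruct H as [t [T1 [T2 _]]].
    assert (H1 : IZR i < IZR zb + 1) by (apply Rmult_lt_reg_r with d; lra).
    assert (H2 : IZR za <= IZR i + 1) by (apply Rmult_le_reg_r with d; lra).
    rewrite <- plus_IZR in H1, H2. apply lt_IZR in H1. apply le_IZR in H2. lia. }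
  assert (Hsub : forall z n, INR (length (stack col (zrange z n))) <= INR (length l)).
  { intros z n. apply le_INR. apply NoDup_incl_length.
    - apply NoDup_stack; auto. apply NoDup_zrange.
    - intros [i j] H. apply in_stack in H. apply Hl, Hc2, H. }
  assert (Ezz : IZR zb - IZR za + 1 >= (b - a) / d).
  { apply Rle_ge, Rle_div_l; auto. lra. }
  exists (length l). split; [|split; [|split]].
  - exists l. split; [apply NoDup_stack; auto; apply NoDup_zrange | auto].
  - intros w Hw Hosc.
    eapply Rle_trans.
    { apply INR_length_stack_le with (K := 2 * (w / d) + 5).
      intros i. apply column_length_upper with i; auto. }
    apply Rmult_le_compat_r.
    { assert (0 <= w / d) by (apply Rdiv_le_0_compat; lra). lra. }
    rewrite length_zrange. unfold n0. rewrite INR_IZR_INZ, Z2Nat.id, plus_IZR, minus_IZR by lia.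
    replace ((b - a) / d) with (b / d - a / d) by (field; lra).
    assert (IZR zb <= b / d) by (apply Rle_div_r; auto).
    assert (a / d < IZR za + 1) by (apply Rlt_div_l; auto). lra.
  - apply Rge_le in Ezz. eapply Rle_trans; [apply Ezz|].
    eapply Rle_trans; [|apply (Hsub za (Z.to_nat (zb - za + 1)))].
    assert (Hcols : forall (n : nat) (z : Z), (za <= z)%Z -> (z + Z.of_nat n <= zb + 1)%Z ->
              INR n <= INR (length (stack col (zrange z n)))).
    { induction n as [|n IH]; intros z H1 H2; [simpl; lra|].
      simpl zrange. rewrite length_stack_cons, plus_INR, S_INR.
      assert (Hz1 : IZR za <= IZR z) by (apply IZR_le; lia).
      assert (Hz2 : IZR z <= IZR zb) by (apply IZR_le; lia).
      apply Rmult_le_compat_r with (r := d) in Hz1; [|lra].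
      apply Rmult_le_compat_r with (r := d) in Hz2; [|lra].
      assert (Hin : exists t, a <= t <= b /\ IZR z * d <= t <= (IZR z + 1) * d).
      (* The leftmost point of [a, b] in column [z]. *)
      { destruct (Rle_dec (IZR z * d) a); [exists a | exists (IZR z * d)]; lra. }
      destruct Hin as [t [T1 T2]].
      destruct (column_length_lower z (col z) t t) as [C _]; auto.
      specialize (IH (z + 1)%Z ltac:(lia) ltac:(lia)). lra. }
    eapply Rle_trans; [|apply Hcols; lia].
    rewrite INR_IZR_INZ, Z2Nat.id, plus_IZR, minus_IZR by lia. lra.
  - intros h psi n z Hh Hpsi Hpsi1 Hz1 Hz2.
    eapply Rle_trans; [apply (RInt_shift_diff_le col); auto|].
    assert (H1 := Hsub z n). assert (H2 := Hsub (z + 1)%Z n).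
    replace (2 * d ^ 2 * INR (length l)) with (d ^ 2 * (INR (length l) + INR (length l))) by ring.
    apply Rmult_le_compat_l; [apply pow2_ge_0|]. lra.
Qed.

End GraphCount.


(** * Box dimension of a lacunary sine series *)

(** Product-to-sum yields a primitive with two terms, each of size at most 1 / (2L), whatever the
    interval. The phase [phi] covers a translated harmonic. *)
Lemma RInt_sin_sin_abs_le (u w phi L A B : R) :
  0 < L -> L <= Rabs (u - w) -> L <= Rabs (u + w) ->
  Rabs (RInt (fun t => sin (w * t) * sin (u * t + phi)) A B) <= 2 / L.
Proof.
  intros HL H1 H2.
  assert (N1 : u - w <> 0) by (intros E; rewrite E, Rabs_R0 in H1; lra).
  assert (N2 : u + w <> 0) by (intros E; rewrite E, Rabs_R0 in H2; lra).
  set (F := fun t => sin ((u - w) * t + phi) / (2 * (u - w))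
                     - sin ((u + w) * t + phi) / (2 * (u + w))).
  assert (H : is_RInt (fun t => sin (w * t) * sin (u * t + phi)) A B (F B - F A)).
  { apply is_RInt_of_derive.
    - intros t. unfold F. auto_derive; auto.
      replace ((u - w) * t + phi) with ((u * t + phi) - w * t) by ring.
      replace ((u + w) * t + phi) with ((u * t + phi) + w * t) by ring.
      rewrite (cos_minus (u * t + phi)), (cos_plus (u * t + phi)). field; auto.
    - intros t; cont. }
  rewrite (is_RInt_unique (V := R_CompleteNormedModule) _ _ _ _ H).
  assert (HF : forall t, Rabs (F t) <= / L).
  { assert (G : forall v t, v <> 0 -> L <= Rabs v -> Rabs (sin (v * t + phi) / (2 * v)) <= / L / 2).
    { intros v t Hv HLv. unfold Rdiv. rewrite Rabs_mult, Rabs_inv, Rabs_mult, (Rabs_pos_eq 2) by lra.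
      replace (/ L * / 2) with (1 * / (2 * L)) by (field; lra).
      apply Rmult_le_compat; [apply Rabs_pos | | apply Rabs_sin_le_1 | ].
      - left. apply Rinv_0_lt_compat. lra.
      - apply Rinv_le_contravar; lra. }
    intros t. unfold F.
    assert (G1 := G _ t N1 H1). assert (G2 := G _ t N2 H2).
    apply Rabs_le_between in G1. apply Rabs_le_between in G2. apply Rabs_le. lra. }
  assert (HA := HF A). assert (HB := HF B).
  apply Rabs_le_between in HA. apply Rabs_le_between in HB. apply Rabs_le.
  unfold Rdiv. lra.
Qed.

(** The primitive is t - sin(wt) cos(wt) / w, and |sin cos| <= 1/2 limits the loss at each endpoint
    to 1 / (2w). *)
Lemma RInt_sin_sqr_ge (w A B : R) : 0 < w ->
  B - A - / w <= RInt (fun t => 2 * sin (w * t) ^ 2) A B.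
Proof.
  intros Hw.
  set (F := fun t => t - sin (w * t) * cos (w * t) / w).
  assert (H : is_RInt (fun t => 2 * sin (w * t) ^ 2) A B (F B - F A)).
  { apply is_RInt_of_derive.
    - intros t. unfold F. auto_derive; auto.
      assert (E := sin2_cos2 (w * t)). unfold Rsqr in E.
      apply Rminus_diag_uniq.
      match goal with |- ?l = 0 => replace l with
        (1 - (sin (w * t) * sin (w * t) + cos (w * t) * cos (w * t))) by (field; lra) end.
      lra.
    - intros t; cont. }
  rewrite (is_RInt_unique (V := R_CompleteNormedModule) _ _ _ _ H).
  assert (HF : forall t, Rabs (sin (w * t) * cos (w * t) / w) <= / w / 2).
  { intros t. unfold Rdiv. rewrite Rabs_mult, (Rabs_pos_eq (/ w)).
    2: left; now apply Rinv_0_lt_compat.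
    rewrite Rmult_comm. apply Rmult_le_compat_l.
    { left; now apply Rinv_0_lt_compat. }
    assert (E := sin2_cos2 (w * t)). unfold Rsqr in E.
    assert (S1 := Rle_0_sqr (sin (w * t) + cos (w * t))).
    assert (S2 := Rle_0_sqr (sin (w * t) - cos (w * t))).
    unfold Rsqr in *. apply Rabs_le. lra. }
  unfold F.
  assert (HA := HF A). assert (HB := HF B).
  apply Rabs_le_between in HA. apply Rabs_le_between in HB. lra.
Qed.

(** Of two distinct powers the smaller is at most half the larger. *)
Lemma pow_gap (Q : R) (m k : nat) : 2 <= Q -> m <> k -> Q ^ m / 2 <= Rabs (Q ^ k - Q ^ m).
Proof.
  intros HQ Hmk.
  assert (G : forall i j, (i < j)%nat -> Q ^ i <= Q ^ j / 2).
  { intros i j Hij. assert (H : Q ^ S i <= Q ^ j) by (apply Rle_pow; [lra|lia]).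
    simpl in H. assert (0 < Q ^ i) by (apply pow_lt; lra). nra. }
  assert (0 < Q ^ m) by (apply pow_lt; lra).
  destruct (Nat.lt_ge_cases m k) as [Hl|Hl].
  - specialize (G m k Hl). rewrite Rabs_pos_eq; lra.
  - specialize (G k m ltac:(lia)). rewrite Rabs_minus_sym, Rabs_pos_eq; lra.
Qed.

Lemma Rabs_sin_diff_le (x y : R) : Rabs (sin x - sin y) <= Rabs (x - y).
Proof.
  destruct (MVT_abs sin cos y x) as [c [E _]].
  { intros; apply derivable_pt_lim_sin. }
  rewrite E. rewrite <- (Rmult_1_l (Rabs (x - y))) at 2.
  apply Rmult_le_compat_r; [apply Rabs_pos | apply Rabs_cos_le_1].
Qed.

(** Interpolates between the trivial bound 2, used for z >= 1, and the Lipschitz bound z, used for z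
    < 1. *)
Lemma Rabs_sin_diff_le_Rpower (x y z beta : R) :
  0 <= beta <= 1 -> 0 < z -> Rabs (x - y) <= z -> Rabs (sin x - sin y) <= 2 * Rpower z beta.
Proof.
  intros Hb Hz Hxy.
  assert (H := Rabs_sin_diff_le x y).
  destruct (Rle_dec 1 z) as [H1|H1].
  - assert (1 <= Rpower z beta).
    { rewrite <- (Rpower_O z) by auto. apply Rle_Rpower; lra. }
    assert (S1 := SIN_bound x). assert (S2 := SIN_bound y).
    apply Rle_trans with 2; [apply Rabs_le|]; lra.
  - assert (z <= Rpower z beta).
    { rewrite <- (Rpower_1 z) at 1 by auto. unfold Rpower.
      assert (Hl : ln z <= 0) by (rewrite <- ln_1; apply Rcomplements.ln_le; lra).
      destruct (Req_dec (1 * ln z) (beta * ln z)) as [->|Hne]; [lra|].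
      left. apply exp_increasing. nra. }
    lra.
Qed.

Lemma Rpower_decr (d x y : R) : 0 < d <= 1 -> x <= y -> Rpower d y <= Rpower d x.
Proof.
  intros Hd Hxy. unfold Rpower.
  assert (Hl : ln d <= 0) by (rewrite <- ln_1; apply Rcomplements.ln_le; lra).
  destruct (Req_dec (y * ln d) (x * ln d)) as [->|Hne]; [lra|].
  left. apply exp_increasing. nra.
Qed.

(** * Hölder regularity and single harmonics of a lacunary series *)

Section LacunarySeries.

Variables (Q : R) (c : nat -> R).
Hypothesis Q_ge_2 : 2 <= Q.
Hypothesis c_pos : forall m, 0 <= c m.
Hypothesis c_sum : ex_series c.

Let V (t : R) : R := Series (fun m => c m * sin ((Q ^ m - 1) * t)).

Lemma lacunary_term_le (m : nat) (x : R) : Rabs (c m * sin x) <= c m.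
Proof.
  rewrite <- (Rabs_pos_eq (c m)) at 2 by auto.
  apply Rabs_mult_le_bounded, Rabs_sin_le_1.
Qed.

Lemma continuous_lacunary (t : R) : continuous V t.
Proof.
  apply (continuous_normal_series (fun m t => c m * sin ((Q ^ m - 1) * t)) c); auto.
  - intros; apply lacunary_term_le.
  - intros m x; cont.
Qed.

Lemma lacunary_bounded (t : R) : Rabs (V t) <= Series c.
Proof. apply Series_dominated; auto. intros; apply lacunary_term_le. Qed.

(* Translation by half a period of the m-th harmonic doubles that harmonic in
   V(t) - V(t + h); every other frequency lies at distance at least Q^m / 2, so the
   remaining terms contribute only O(Q^-m). *)
Lemma lacunary_fourier_lower (m : nat) (A B : R) : (1 <= m)%nat -> A <= B ->
  c m * (B - A) - 8 / Q ^ m * Series c <=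
  RInt (fun t => (V t - V (t + PI / (Q ^ m - 1))) * sin ((Q ^ m - 1) * t)) A B.
Proof.
  intros Hm HAB.
  assert (HQm : 2 <= Q ^ m).
  { apply Rle_trans with (Q ^ 1); [simpl; lra | apply Rle_pow; [lra|lia]]. }
  set (h := PI / (Q ^ m - 1)). set (w := Q ^ m - 1).
  assert (Hwh : w * h = PI) by (unfold w, h; field; lra).
  set (f := fun k t => c k * sin ((Q ^ k - 1) * t) - c k * sin ((Q ^ k - 1) * (t + h))).
  assert (fA : forall k t, Rabs (f k t) <= 2 * c k).
  { intros k t. unfold f.
    assert (H1 := lacunary_term_le k ((Q ^ k - 1) * t)).
    assert (H2 := lacunary_term_le k ((Q ^ k - 1) * (t + h))).
    apply Rabs_le_between in H1. apply Rabs_le_between in H2. apply Rabs_le. lra. }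
  assert (fc : forall k t, continuous (f k) t) by (intros k t; unfold f; cont).
  assert (HA : ex_series (fun k => 2 * c k)).
  { apply (ex_series_scal_l (K := R_AbsRing) (V := R_NormedModule)); auto. }
  assert (wc : forall t, continuous (fun t => sin (w * t)) t) by (intros t; cont).
  assert (HS := is_series_RInt_normal_series f _ fA HA fc (fun t => sin (w * t)) wc A B 1
                  (fun x _ => Rabs_sin_le_1 (w * x))).
  rewrite (RInt_ext _ (fun t => sin (w * t) * Series (fun k => f k t))).
  2: { intros t _. eqR. unfold V, f. rewrite Series_minus; [ring| |];
       apply ex_series_dominated with c; auto; intros; apply lacunary_term_le. }
  (* The termwise minorant: the main term sits at index [m], and every index [k] loses at most 8 c_k
     / Q^m, that is 4 / Q^m for each of the two oscillating integrals. *)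
  assert (Hlow : is_series (fun k => (if (m =? k)%nat then c m * (B - A) else 0)
                                     + - (8 / Q ^ m) * c k)
                           (c m * (B - A) + - (8 / Q ^ m) * Series c)).
  { apply is_series_Rplus; [apply is_series_indicator|].
    now apply is_series_Rmult, Series_correct. }
  replace (c m * (B - A) - 8 / Q ^ m * Series c)
    with (c m * (B - A) + - (8 / Q ^ m) * Series c) by ring.
  rewrite <- (is_series_unique _ _ Hlow), <- (is_series_unique _ _ HS).
  apply Series_le_series.
  { eexists; apply Hlow. }
  { eexists; apply HS. }
  intros k.
  assert (Hex : forall g : R -> R, (forall t, continuous g t) -> ex_RInt g A B).
  { intros g Hg. apply (@ex_RInt_continuous R_CompleteNormedModule); auto. }
  assert (Hinv : 0 < / Q ^ m) by (apply Rinv_0_lt_compat; lra).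
  destruct (Nat.eqb_spec m k) as [<-|Hmk].
  - rewrite (RInt_ext _ (fun t => scal (c m) (2 * sin (w * t) ^ 2))).
    2: { intros t _. unfold f, scal; simpl; unfold mult; simpl; eqR. fold w.
         rewrite Rmult_plus_distr_l, Hwh, neg_sin. ring. }
    rewrite (@RInt_scal R_CompleteNormedModule) by (apply Hex; intros t; cont).
    unfold scal; simpl; unfold mult; simpl.
    assert (H := RInt_sin_sqr_ge w A B ltac:(unfold w; lra)). simpl in H.
    apply Rle_trans with (c m * (B - A - / w)); [|now apply Rmult_le_compat_l].
    assert (/ w <= 2 * / Q ^ m).
    { apply Rle_trans with (/ (Q ^ m / 2)).
      - apply Rinv_le_contravar; unfold w; lra.
      - right; field; lra. }
    assert (0 <= c m * (8 * / Q ^ m - / w)) by (apply Rmult_le_pos; [auto|lra]).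
    unfold Rdiv. lra.
  - rewrite (RInt_ext _ (fun t => scal (c k)
       (minus (sin (w * t) * sin ((Q ^ k - 1) * t + 0))
              (sin (w * t) * sin ((Q ^ k - 1) * t + (Q ^ k - 1) * h))))).
    2: { intros t _. unfold f, scal, minus, plus, opp; simpl; unfold mult; simpl; eqR.
         rewrite Rmult_plus_distr_l, Rplus_0_r. ring. }
    rewrite (@RInt_scal R_CompleteNormedModule).
    2: { apply (@ex_RInt_minus R_NormedModule); apply Hex; intros t; cont. }
    rewrite (@RInt_minus R_CompleteNormedModule); try (apply Hex; intros t; cont).
    assert (G1 : Q ^ m / 2 <= Rabs (Q ^ k - 1 - w)).
    { unfold w. replace (Q ^ k - 1 - (Q ^ m - 1)) with (Q ^ k - Q ^ m) by ring.
      now apply pow_gap. }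
    assert (G2 : Q ^ m / 2 <= Rabs (Q ^ k - 1 + w)).
    { assert (1 <= Q ^ k) by (apply pow_R1_Rle; lra).
      unfold w. rewrite Rabs_pos_eq; lra. }
    assert (B1 := RInt_sin_sin_abs_le (Q ^ k - 1) w 0 (Q ^ m / 2) A B ltac:(lra) G1 G2).
    assert (B2 := RInt_sin_sin_abs_le (Q ^ k - 1) w ((Q ^ k - 1) * h) (Q ^ m / 2) A B ltac:(lra) G1 G2).
    set (X := RInt (fun t => sin (w * t) * sin ((Q ^ k - 1) * t + 0)) A B) in *.
    set (Y := RInt _ A B) in B2 |- *.
    change (0 + - (8 / Q ^ m) * c k <= c k * (X - Y)).
    replace (2 / (Q ^ m / 2)) with (4 / Q ^ m) in B1, B2 by (field; lra).
    apply Rabs_le_between in B1. apply Rabs_le_between in B2.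
    assert (0 <= c k * (8 / Q ^ m + (X - Y))) by (apply Rmult_le_pos; [auto|lra]).
    lra.
Qed.

(** The m-th term varies by at most 2 c_m (Q^m |t - u|)^beta, and the sum over m is geometric with
    ratio p Q^beta < 1. *)
Lemma lacunary_holder (C p beta : R) :
  (forall m, c m <= C * p ^ m) -> 0 <= C -> 0 < p -> 0 <= beta <= 1 -> p * Rpower Q beta < 1 ->
  exists H, 0 <= H /\ forall t u, t <> u -> Rabs (V t - V u) <= H * Rpower (Rabs (t - u)) beta.
Proof.
  intros Hc HC Hp Hb Hpb.
  set (y := p * Rpower Q beta) in *.
  assert (Hy : 0 < y) by (apply Rmult_lt_0_compat; auto; apply exp_pos).
  assert (HG := ex_series_geom_pow y ltac:(lra)).
  exists (2 * C * Series (fun m => y ^ m)).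
  split.
  { apply Rmult_le_pos; [lra|]. apply Rle_trans with (Series (fun m => 0 * y ^ m)).
    - rewrite Series_scal_l; lra.
    - apply Series_le; auto. intros m. assert (0 < y ^ m) by now apply pow_lt. lra. }
  intros t u Htu.
  assert (Hd : 0 < Rabs (t - u)) by (apply Rabs_pos_lt; lra).
  set (d := Rabs (t - u)) in *.
  unfold V. rewrite <- Series_minus;
    try (apply ex_series_dominated with c; auto; intros; apply lacunary_term_le).
  replace (2 * C * Series (fun m => y ^ m) * Rpower d beta)
    with (Series (fun m => (2 * C * Rpower d beta) * y ^ m))
    by (rewrite (Series_scal_l (2 * C * Rpower d beta) (fun m => y ^ m)); ring).
  apply Series_dominated.
  2: { apply (ex_series_scal_l (K := R_AbsRing) (V := R_NormedModule)); auto. }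
  intros m.
  assert (Q1 : 1 <= Q ^ m) by (apply pow_R1_Rle; lra).
  rewrite <- Rmult_minus_distr_l, Rabs_mult, Rabs_pos_eq by auto.
  assert (Hs : Rabs (sin ((Q ^ m - 1) * t) - sin ((Q ^ m - 1) * u)) <= 2 * Rpower (Q ^ m * d) beta).
  { apply Rabs_sin_diff_le_Rpower; auto.
    - apply Rmult_lt_0_compat; lra.
    - rewrite <- Rmult_minus_distr_l, Rabs_mult, Rabs_pos_eq by lra. fold d.
      apply Rmult_le_compat_r; lra. }
  assert (E : Rpower (Q ^ m * d) beta = Rpower Q beta ^ m * Rpower d beta).
  { rewrite <- Rpower_mult_distr by lra. f_equal.
    rewrite <- (Rpower_pow m Q), <- (Rpower_pow m (Rpower Q beta)), !Rpower_mult
      by (try apply exp_pos; lra).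
    f_equal; ring. }
  rewrite E in Hs.
  apply Rle_trans with ((C * p ^ m) * (2 * (Rpower Q beta ^ m * Rpower d beta))).
  - apply Rmult_le_compat; auto. apply Rabs_pos.
  - unfold y. rewrite Rpow_mult_distr. right; ring.
Qed.

End LacunarySeries.

(** After taking logarithms and dividing by ln(1/d), the constants k and K contribute only O(1 /
    ln(1/d)). *)
Lemma has_box_dim_of_power_bounds (S : R * R -> Prop) (D : R) :
  (forall eps, 0 < eps -> exists k K d1, 0 < k /\ 0 < K /\ 0 < d1 /\
     forall d, 0 < d < d1 -> exists n, box_count S d n /\
       k * Rpower d (- (D - eps)) <= INR n <= K * Rpower d (- (D + eps))) ->
  has_box_dim S D.
Proof.
  intros H eps He.
  destruct (H (eps / 2) ltac:(lra)) as [k [K [d1 [Hk [HK [Hd1 Hn]]]]]].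
  (* Half of eps is spent on the exponents. For ln(1/d) > T the logarithms of the constants stay
     below the other half; the summand 1 makes T positive. *)
  set (T := 2 * (Rabs (ln k) + Rabs (ln K) + 1) / eps).
  assert (HT : 0 < T).
  { apply Rdiv_lt_0_compat; auto.
    assert (A1 := Rabs_pos (ln k)). assert (A2 := Rabs_pos (ln K)). lra. }
  exists (Rmin d1 (exp (- T))). split.
  { apply Rmin_pos; auto. apply exp_pos. }
  intros d [Hd Hd'].
  assert (Hda := Rlt_le_trans _ _ _ Hd' (Rmin_l _ _)).
  assert (Hdb := Rlt_le_trans _ _ _ Hd' (Rmin_r _ _)).
  destruct (Hn d (conj Hd Hda)) as [n [Hbox [Hlo Hup]]].
  exists n. split; auto.
  apply ln_increasing in Hdb; auto. rewrite ln_exp in Hdb.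
  replace (1 / d) with (/ d) by (unfold Rdiv; ring). rewrite ln_Rinv by auto.
  set (X := - ln d). assert (HX : T < X) by (unfold X; lra).
  assert (P1 : 0 < k * Rpower d (- (D - eps / 2))) by (apply Rmult_lt_0_compat; auto; apply exp_pos).
  assert (Hlo' := Rcomplements.ln_le _ _ P1 Hlo).
  assert (Hup' := Rcomplements.ln_le _ _ (Rlt_le_trans _ _ _ P1 Hlo) Hup).
  rewrite ln_mult in Hlo' by (auto; apply exp_pos).
  rewrite ln_mult in Hup' by (auto; apply exp_pos).
  unfold Rpower in Hlo', Hup'. rewrite ln_exp in Hlo', Hup'.
  replace (- (D - eps / 2) * ln d) with ((D - eps / 2) * X) in Hlo' by (unfold X; ring).
  replace (- (D + eps / 2) * ln d) with ((D + eps / 2) * X) in Hup' by (unfold X; ring).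
  assert (HTe : 2 * (Rabs (ln k) + Rabs (ln K) + 1) < X * eps).
  { apply Rlt_div_l; auto. }
  assert (A1 := Rabs_pos (ln k)). assert (A2 := Rabs_pos (ln K)).
  assert (A3 := Rle_abs (ln K)). assert (A4 := Rle_abs (- ln k)). rewrite Rabs_Ropp in A4.
  replace (ln (INR n) / X - D) with ((ln (INR n) - D * X) / X) by (field; lra).
  unfold Rdiv. rewrite Rabs_mult, Rabs_inv, (Rabs_pos_eq X) by lra.
  apply Rlt_div_l; [lra|]. apply Rabs_lt_between. lra.
Qed.

(** Descending from a large power, the last one still at least X exceeds X by a factor of at most
    Q. *)
Lemma pow_between (Q X : R) : 1 < Q -> 1 <= X -> exists m, X <= Q ^ m <= Q * X.
Proof.
  intros HQ HX.
  assert (G : forall n, X <= Q ^ n -> exists m, X <= Q ^ m <= Q * X).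
  { induction n as [|n IH]; intros H.
    - exists 0%nat. simpl in *. split; auto. nra.
    - destruct (Rle_dec X (Q ^ n)) as [Hn|Hn]; auto.
      exists (S n). split; auto. simpl. apply Rmult_le_compat_l; lra. }
  destruct (Pow_x_infinity Q) with (b := X) as [N HN].
  { rewrite Rabs_pos_eq; lra. }
  apply (G N). specialize (HN N (le_n N)).
  rewrite Rabs_pos_eq in HN; [lra|]. apply pow_le; lra.
Qed.

Lemma Rpower_minus_2 (d x : R) : 0 < d -> Rpower d (x - 2) = Rpower d x / d ^ 2.
Proof.
  intros Hd. unfold Rminus. rewrite Rpower_plus, Rpower_Ropp.
  change 2 with (INR 2) at 1. rewrite Rpower_pow by auto. reflexivity.
Qed.


(** For d <= 1 and beta <= 1 both 1/d and d^beta / d are at least 1, so they absorb the additive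
    constants 3 and 5. *)
Lemma holder_count_le (a b d H beta N : R) :
  a < b -> 0 < d <= 1 -> 0 <= H -> beta <= 1 ->
  N <= ((b - a) / d + 3) * (2 * (H * Rpower d beta / d) + 5) ->
  N <= (b - a + 3) * (2 * H + 5) * Rpower d (beta - 2).
Proof.
  intros Hab Hd HH Hb HN.
  rewrite Rpower_minus_2 by lra.
  assert (Hy : d <= Rpower d beta).
  { rewrite <- (Rpower_1 d) at 1 by lra. apply Rpower_decr; lra. }
  set (y := Rpower d beta) in *.
  apply Rle_trans with (1 := HN).
  assert (Hi : 1 <= / d) by (rewrite <- Rinv_1; apply Rinv_le_contravar; lra).
  assert (Hyd : 1 <= y / d) by (apply Rle_div_r; lra).
  replace ((b - a + 3) * (2 * H + 5) * (y / d ^ 2))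
    with (((b - a + 3) * / d) * ((2 * H + 5) * (y / d))) by (field; lra).
  assert (Hba : 0 <= (b - a) * / d) by (apply Rmult_le_pos; lra).
  assert (HHy : 0 <= H * (y / d)) by (apply Rmult_le_pos; lra).
  apply Rmult_le_compat; unfold Rdiv in *; lra.
Qed.

(** * Box dimension when the coefficients have exact geometric order *)

Section LacunaryDimension.

Variables (Q alpha k K : R) (c : nat -> R).
Hypothesis Q_ge_2 : 2 <= Q.
Hypothesis alpha_pos : 0 < alpha.
Hypothesis k_pos : 0 < k.
Hypothesis c_pos : forall m, 0 <= c m.
Hypothesis c_le : forall m, c m <= K * Rpower Q (- alpha) ^ m.
(** The bound starts at m = 1 because the constant harmonic of the velocity has coefficient 0. *)
Hypothesis c_ge : forall m, (1 <= m)%nat -> k * Rpower Q (- alpha) ^ m <= c m.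

Let V (t : R) : R := Series (fun m => c m * sin ((Q ^ m - 1) * t)).
Let p := Rpower Q (- alpha).

Lemma lacunary_ratio : 0 < p < 1.
Proof. apply Rpower_lt_1; lra. Qed.

Lemma ex_series_lacunary_coef : ex_series c.
Proof.
  assert (Hp := lacunary_ratio).
  apply ex_series_dominated with (fun m => K * p ^ m).
  - intros m. rewrite Rabs_pos_eq; auto.
  - apply (ex_series_scal_l (K := R_AbsRing) (V := R_NormedModule)).
    apply ex_series_geom_pow; lra.
Qed.

Lemma lacunary_amplitude_pos : 0 <= K.
Proof.
  assert (H0 := c_le 0). assert (H1 := c_pos 0). simpl in H0. lra.
Qed.

(* The scale [d] is matched with the harmonic whose half period is just below [d]. *)
Lemma lacunary_count_lower (a b : R) : a < b -> alpha < 1 ->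
  exists k' d1, 0 < k' /\ 0 < d1 <= 1 /\
  forall d (N : nat), 0 < d < d1 ->
  (forall (h : R) (psi : R -> R) (n : nat) (z : Z),
    0 <= h <= d -> (forall t, continuous psi t) -> (forall t, Rabs (psi t) <= 1) ->
    a <= IZR z * d -> (IZR z + INR n + 1) * d <= b ->
    RInt (fun t => (V t - V (t + h)) * psi t) (IZR z * d) ((IZR z + INR n) * d)
    <= 2 * d ^ 2 * INR N) ->
  k' * Rpower d (alpha - 2) <= INR N.
Proof.
  intros Hab Ha1.
  assert (Hp := lacunary_ratio). assert (Hsum := ex_series_lacunary_coef).
  assert (PIp := PI_RGT_0).
  set (L := (b - a) / 2). assert (HL : 0 < L) by (unfold L; lra).
  (* This is where alpha < 1 enters: the coefficients p^m decay more slowly than the error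
     Q^(-m). *)
  assert (HpQ : 1 < p * Q).
  { unfold p. rewrite <- (Rpower_1 Q) at 2 by lra. rewrite <- Rpower_plus.
    rewrite <- (Rpower_O Q) at 1 by lra. apply Rpower_lt; lra. }
  (* From [m0] on, the error 8 / Q^m times the sum of [c] is at most half of the main term k p^m
     L. *)
  destruct (Pow_x_infinity (p * Q)) with (b := 16 * Series c / (k * L)) as [m0 Hm0].
  { rewrite Rabs_pos_eq; lra. }
  (* The remaining half of k p^m L, divided by 2 d^2, gives the factor 1/4; Q^m <= Q (2 pi / d)
     gives the power of 2 pi Q. *)
  set (k' := k * L / 4 * Rpower (Q * (2 * PI)) (- alpha)).
  set (m1 := S m0).
  assert (Qm1 : 0 < Q ^ m1) by (apply pow_lt; lra).
  (* The bound (b - a) / 6 leaves length at least L after the loss of up to 3d at the ends; the last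
     bound forces the chosen harmonic to have index at least [m1], hence above [m0] and at least
     1. *)
  exists k', (Rmin (Rmin 1 ((b - a) / 6)) (2 * PI / Q ^ m1)).
  split; [|split; [split|]].
  - apply Rmult_lt_0_compat; [|apply exp_pos].
    assert (0 < k * L) by (apply Rmult_lt_0_compat; auto). lra.
  - apply Rmin_pos; [apply Rmin_pos; lra|]. apply Rdiv_lt_0_compat; lra.
  - eapply Rle_trans; apply Rmin_l.
  - intros d N [Hd Hd'] HN.
    assert (D1 := Rlt_le_trans _ _ _ Hd' (Rmin_l _ _)).
    assert (D3 := Rlt_le_trans _ _ _ Hd' (Rmin_r _ _)).
    assert (D2 := Rlt_le_trans _ _ _ D1 (Rmin_r _ _)).
    apply (fun H => Rlt_le_trans _ _ _ H (Rmin_l _ _)) in D1.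
    assert (HX : Q ^ m1 < 2 * PI / d).
    { apply (Rlt_div_r _ _ d); auto. apply (Rlt_div_r _ _ (Q ^ m1)) in D3; auto.
      now rewrite Rmult_comm. }
    assert (Q1 : 1 <= Q ^ m1) by (apply pow_R1_Rle; lra).
    destruct (pow_between Q (2 * PI / d)) as [m [M1 M2]]; try lra.
    assert (Hm : (m1 <= m)%nat).
    { destruct (Nat.le_gt_cases m1 m) as [|Hlt]; auto. exfalso.
      assert (Q ^ m <= Q ^ m1) by (apply Rle_pow; [lra|lia]). lra. }
    unfold m1 in Hm.
    assert (Qm2 : 2 <= Q ^ m).
    { apply Rle_trans with (Q ^ 1); [simpl; lra | apply Rle_pow; [lra|lia]]. }
    (* Since Q^m >= 2 gives Q^m - 1 >= Q^m / 2, the choice Q^m >= 2 pi / d keeps the half period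
       within d. *)
    assert (Hh : 0 <= PI / (Q ^ m - 1) <= d).
    { split; [apply Rdiv_le_0_compat; lra|].
      apply Rle_div_l; [lra|]. apply Rle_div_l in M1; auto.
      assert (0 <= d * (Q ^ m - 2)) by (apply Rmult_le_pos; lra). lra. }
    destruct (floor_exists (a / d)) as [za [A1 A2]].
    destruct (floor_exists (b / d)) as [zb [B1 B2]].
    apply Rle_div_r in A1; auto. apply Rlt_div_l in A2; auto.
    apply Rle_div_r in B1; auto. apply Rlt_div_l in B2; auto.
    assert (Hz : (za + 2 <= zb)%Z).
    { apply le_IZR. rewrite plus_IZR. apply Rmult_le_reg_r with d; lra. }
    (* The columns za + 1 to zb - 2, so that the shifted points remain in [a, b]. *)
    set (n := Z.to_nat (zb - za - 2)).
    assert (Hn : INR n = IZR zb - IZR za - 2).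
    { unfold n. rewrite INR_IZR_INZ, Z2Nat.id by lia. now rewrite !minus_IZR. }
    assert (HI := HN (PI / (Q ^ m - 1)) (fun t => sin ((Q ^ m - 1) * t)) n (za + 1)%Z Hh
              ltac:(intros t; cont) ltac:(intros t; apply Rabs_sin_le_1)).
    rewrite plus_IZR, Hn in HI.
    replace (IZR za + 1 + (IZR zb - IZR za - 2)) with (IZR zb - 1) in HI by ring.
    specialize (HI ltac:(lra) ltac:(lra)).
    assert (HF := lacunary_fourier_lower Q c Q_ge_2 c_pos Hsum m
       ((IZR za + 1) * d) ((IZR zb - 1) * d) ltac:(lia) ltac:(lra)).
    cbv zeta beta in HF. fold V in HF.
    assert (HF2 := Rle_trans _ _ _ HF HI). clear HF HI.
    set (BA := (IZR zb - 1) * d - (IZR za + 1) * d) in *.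
    assert (HBA : L <= BA) by (unfold L, BA; lra).
    assert (Hcm := c_ge m ltac:(lia)). fold p in Hcm.
    assert (Ppm : 0 < p ^ m) by (apply pow_lt; lra).
    assert (Hc1 : k * p ^ m * L <= c m * BA).
    { apply Rmult_le_compat; try lra. apply Rmult_le_pos; lra. }
    assert (Hc2 : 8 / Q ^ m * Series c <= k * p ^ m * L / 2).
    { specialize (Hm0 m ltac:(lia)).
      assert (HpQm : 0 < (p * Q) ^ m) by (apply pow_lt; lra).
      rewrite Rabs_pos_eq in Hm0 by lra.
      apply Rge_le, Rle_div_l in Hm0; [|now apply Rmult_lt_0_compat].
      rewrite Rpow_mult_distr in Hm0.
      replace (8 / Q ^ m * Series c) with (8 * Series c / Q ^ m) by (field; lra).
      apply Rle_div_l; [lra|]. lra. }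
    assert (Hpm : Rpower (Q * (2 * PI)) (- alpha) * Rpower d alpha <= p ^ m).
    { replace (p ^ m) with (Rpower (Q ^ m) (- alpha)).
      2: { unfold p. rewrite <- (Rpower_pow m Q), <- (Rpower_pow m (Rpower Q _)), !Rpower_mult
             by (try apply exp_pos; lra). f_equal; ring. }
      replace (Rpower d alpha) with (Rpower (/ d) (- alpha)).
      2: { unfold Rpower. rewrite ln_Rinv by auto. f_equal; ring. }
      rewrite Rpower_mult_distr by (try apply Rinv_0_lt_compat; auto; nra).
      rewrite !Rpower_Ropp. apply Rinv_le_contravar; [apply exp_pos|].
      apply Rle_Rpower_l; [lra|]. unfold Rdiv in M2. lra. }
    rewrite Rpower_minus_2 by auto.
    unfold k'.
    set (U := Rpower (Q * (2 * PI)) (- alpha)) in *. set (y := Rpower d alpha) in *.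
    replace (k * L / 4 * U * (y / d ^ 2)) with (k * L / 4 * (U * y) / d ^ 2) by (field; lra).
    assert (Hd2 : 0 < d ^ 2) by (apply pow_lt; auto).
    apply Rle_div_l; auto.
    assert (k * L * (U * y) <= k * L * p ^ m).
    { apply Rmult_le_compat_l; auto. apply Rmult_le_pos; lra. }
    lra.
Qed.

(** Hölder exponents below min(alpha, 1) give the upper count. The lower count comes from the test
    integral when alpha < 1 and from the number of columns otherwise. *)
Lemma lacunary_box_dim (a b : R) : a < b ->
  has_box_dim (graph_on V a b) (Rmax (2 - alpha) 1).
Proof.
  intros Hab.
  assert (Hp := lacunary_ratio). assert (Hsum := ex_series_lacunary_coef).
  set (D := Rmax (2 - alpha) 1).
  assert (HD : (alpha < 1 /\ D = 2 - alpha) \/ (1 <= alpha /\ D = 1)).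
  { unfold D. destruct (Rlt_le_dec alpha 1); [left | right]; split; auto.
    - apply Rmax_left; lra.
    - apply Rmax_right; lra. }
  apply has_box_dim_of_power_bounds. intros eps He.
  assert (Hbeta : exists beta, 0 <= beta <= 1 /\ beta < alpha /\ 2 - beta <= D + eps).
  (* Here 2 - D = min(alpha, 1), so this exponent is just below it; the maximum with 0 takes care of
     large eps. *)
  { exists (Rmax (2 - D - eps) 0).
    assert (0 < 2 - D <= 1 /\ 2 - D <= alpha) by lra.
    unfold Rmax; destruct (Rle_dec (2 - D - eps) 0); lra. }
  destruct Hbeta as [beta [B1 [B2 B3]]].
  assert (Hpb : p * Rpower Q beta < 1).
  { unfold p. rewrite <- Rpower_plus. apply Rpower_lt_1; lra. }
  destruct (lacunary_holder Q c Q_ge_2 c_pos Hsum K p beta c_le lacunary_amplitude_pos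
              ltac:(lra) B1 Hpb) as [H [H0 HH]].
  cbv zeta in HH. fold V in HH.
  assert (Vc : forall t, continuous V t) by (intros t; now apply continuous_lacunary).
  assert (Vb : forall t, Rabs (V t) <= Series c) by (intros t; now apply lacunary_bounded).
  assert (Hlow : exists k' d1, 0 < k' /\ 0 < d1 <= 1 /\ forall d (N : nat), 0 < d < d1 ->
     (b - a) / d <= INR N ->
     (forall (h : R) (psi : R -> R) (n : nat) (z : Z),
    0 <= h <= d -> (forall t, continuous psi t) -> (forall t, Rabs (psi t) <= 1) ->
    a <= IZR z * d -> (IZR z + INR n + 1) * d <= b ->
    RInt (fun t => (V t - V (t + h)) * psi t) (IZR z * d) ((IZR z + INR n) * d)
    <= 2 * d ^ 2 * INR N) -> k' * Rpower d (- D) <= INR N).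
  { destruct HD as [[Ha ->]|[Ha ->]].
    - destruct (lacunary_count_lower a b Hab Ha) as [k' [d1 [K1 [K2 K3]]]].
      exists k', d1. split; [|split]; auto. intros d N Hd _ HN.
      replace (- (2 - alpha)) with (alpha - 2) by ring. now apply K3.
    - exists (b - a), 1. split; [lra|split; [lra|]]. intros d N Hd HN _.
      rewrite Rpower_Ropp, Rpower_1 by lra. apply HN. }
  destruct Hlow as [k' [d1 [K1 [K2 K3]]]].
  exists k', ((b - a + 3) * (2 * H + 5)), d1.
  split; [auto|split; [apply Rmult_lt_0_compat; lra|split; [lra|]]].
  intros d Hd.
  destruct (graph_box_count V a b d (Series c) Vc Vb Hab ltac:(lra)) as [N [Hbox [Hup [Hcols Hint]]]].
  exists N. split; auto. split.
  - apply Rle_trans with (k' * Rpower d (- D)).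
    + apply Rmult_le_compat_l; [lra|]. apply Rpower_decr; lra.
    + apply K3; auto.
  - assert (Hw : 0 <= H * Rpower d beta).
    { apply Rmult_le_pos; auto. left; apply exp_pos. }
    eapply Rle_trans.
    + apply (holder_count_le a b d H beta (INR N)); try lra.
      apply Hup; auto.
      intros t u _ _ Htu.
      (* Both the Hölder bound and the monotonicity of [Rpower] in its base are applied at a
         positive distance, so t = u is treated apart. *)
      destruct (Req_dec t u) as [->|Hne].
      { replace (V u - V u) with 0 by ring. now rewrite Rabs_R0. }
      apply Rle_trans with (1 := HH t u Hne).
      apply Rmult_le_compat_l; auto.
      apply Rle_Rpower_l; [lra|]. split; auto. apply Rabs_pos_lt; lra.
    + apply Rmult_le_compat_l.
      { apply Rmult_le_pos; lra. }
      apply Rpower_decr; lra.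
Qed.

End LacunaryDimension.

(** * The velocity as an instance of the lacunary series *)

Lemma Nnorm_sqr_pos (q : nat) (s : R) : (2 <= q)%nat -> s < 2 -> 0 < Nnorm q s ^ 2.
Proof.
  intros Hq Hs. apply pow_lt, sqrt_lt_R0.
  assert (Hq2 := INR_ge_2 q Hq).
  apply Rmult_lt_0_compat.
  - apply Rdiv_lt_0_compat; [lra | apply PI_RGT_0].
  - assert (H := Rpower_lt_1 (INR q) (2 * (s - 2)) ltac:(lra) ltac:(lra)). lra.
Qed.

(** Both sides are q^(s - 3); with Q = q^2 this identifies alpha = (3 - s) / 2. *)
Lemma velocity_ratio (q : nat) (s : R) : (2 <= q)%nat ->
  Rpower (INR q) (s - 2) * INR q / INR q ^ 2 = Rpower (INR q ^ 2) (- ((3 - s) / 2)).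
Proof.
  intros Hq. assert (Hq2 := INR_ge_2 q Hq).
  rewrite <- (Rpower_pow 2 (INR q)) by lra.
  rewrite Rpower_mult. unfold Rdiv. rewrite <- Rpower_Ropp.
  rewrite <- (Rpower_1 (INR q)) at 2 by lra.
  rewrite <- !Rpower_plus. f_equal. simpl (INR 2). lra.
Qed.

(** Replacing the denominator Y - 1 by the larger Y gives the exact geometric term. *)
Lemma velocity_coef_lower (q : nat) (s : R) (m : nat) : (2 <= q)%nat -> (1 <= m)%nat ->
  8 * Nnorm q s ^ 2 * (Rpower (INR q) (s - 2) * INR q / INR q ^ 2) ^ m <= velocity_coef q s m.
Proof.
  intros Hq Hm. assert (Hq2 := INR_ge_2 q Hq).
  destruct m as [|m]; [lia|]. unfold velocity_coef.
  assert (H4 : 2 <= (INR q ^ 2) ^ S m).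
  { rewrite <- pow_mult. apply INR_pow_ge_2; auto; lia. }
  rewrite (Rdiv_def _ (INR q ^ 2)), !Rpow_mult_distr, pow_inv.
  set (Y := (INR q ^ 2) ^ S m) in *.
  set (X := Rpower (INR q) (s - 2) ^ S m * INR q ^ S m).
  assert (HX : 0 < X).
  { apply Rmult_lt_0_compat; apply pow_lt; [apply exp_pos | lra]. }
  unfold Rdiv. rewrite <- Rmult_assoc.
  apply Rmult_le_compat_l.
  - apply Rmult_le_pos; [|lra]. assert (H := pow2_ge_0 (Nnorm q s)). lra.
  - apply Rinv_le_contravar; lra.
Qed.

Theorem theorem1 (q : nat) (s : R) :
  (2 <= q)%nat -> Nat.Even q -> 0 < s < 2 ->
  (forall t, ex_derive (avg_x q s) t) /\
  (forall t, continuous (Derive (avg_x q s)) t) /\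
  (forall a b, a < b ->
     has_box_dim (graph_on (Derive (avg_x q s)) a b) (Rmax ((1 + s) / 2) 1)).
Proof.
  intros Hq He Hs.
  assert (Hq2 := INR_ge_2 q Hq).
  assert (HD : forall t, is_derive (avg_x q s) t (velocity q s t)).
  { intros t. now apply is_derive_avg_x. }
  (* An equality of functions, so that both the continuity and the graph statement can be rewritten
     to [velocity]. *)
  assert (E : Derive (avg_x q s) = velocity q s).
  { apply functional_extensionality. intros t.
    now apply is_derive_unique. }
  rewrite E.
  destruct (velocity_coef_bounds q s Hq Hs) as [_ Hc].
  assert (Hc0 : forall m, 0 <= velocity_coef q s m) by (intros; apply Hc).
  assert (Hc1 : forall m, velocity_coef q s m <=
              16 * Nnorm q s ^ 2 * Rpower (INR q ^ 2) (- ((3 - s) / 2)) ^ m).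
  { intros m. rewrite <- velocity_ratio by auto. apply Hc. }
  assert (HN := Nnorm_sqr_pos q s Hq ltac:(lra)).
  assert (HQ : 2 <= INR q ^ 2) by (simpl; nra).
  split; [|split].
  - intros t. eexists; apply HD.
  - intros t. apply continuous_lacunary; auto.
    apply (ex_series_lacunary_coef (INR q ^ 2) ((3 - s) / 2) (16 * Nnorm q s ^ 2)); auto; lra.
  - intros a b Hab.
    replace ((1 + s) / 2) with (2 - (3 - s) / 2) by lra.
    apply (lacunary_box_dim (INR q ^ 2) ((3 - s) / 2) (8 * Nnorm q s ^ 2) (16 * Nnorm q s ^ 2));
      auto; try lra.
    intros m Hm. rewrite <- velocity_ratio by auto. now apply velocity_coef_lower.
Qed.
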